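(* The category $\mathrm{Coll}_2$ of bicollections, endowed with the horizontal monoidal structure $(\otimes_h,\mathbf 1_h)$ and the vertical monoidal structure $(\boxtimes,\mathbf 1_v)$, is a duoidal category (the interchange transformation being the exchange map $R$, and the unit maps being those given in the context).
   Context: All vector spaces are over $\mathbb C$. A bicollection is a family $P=(P(n,m))_{n,m\ge 0}$ of vector spaces; a morphism $P\to Q$ is a family of linear maps $P(n,m)\to Q(n,m)$. $\mathrm{Coll}_2$ denotes the category of bicollections. Horizontal tensor product: $(P\otimes_h Q)(n,m)=\bigoplus_{n_1+n_2=n,\ m_1+m_2=m}P(n_1,m_1)\otimes Q(n_2,m_2)$, and similarly on morphisms. Its unit is $\mathbf 1_h$ with $\mathbf 1_h(0,0)=\mathbb C$ (generator written $1_0$) and $\mathbf 1_h(n,m)=0$ otherwise. Vertical tensor product: $(P\boxtimes Q)(n,m)=\bigoplus_{k\ge 0}P(n,k)\otimes Q(k,m)$, and similarly on morphisms. Its unit is $\mathbf 1_v$ with $\mathbf 1_v(n,n)=\mathbb C 1_n$ and $\mathbf 1_v(n,m)=0$ for $n\ne m$. Exchange map: for bicollections $C_1,\dots,C_4$, $R_{C_1,C_2,C_3,C_4}:(C_1\boxtimes C_2)\otimes_h(C_3\boxtimes C_4)\to(C_1\otimes_h C_3)\boxtimes(C_2\otimes_h C_4)$ is the linear map $(p^1\boxtimes p^2)\otimes_h(p^3\boxtimes p^4)\mapsto(p^1\otimes_h p^3)\boxtimes(p^2\otimes_h p^4)$. Unit maps: $\mathbf 1_h\to\mathbf 1_h\boxtimes\mathbf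 1_h$, $1_0\mapsto 1_0\boxtimes 1_0$; $\mathbf 1_v\otimes_h\mathbf 1_v\to\mathbf 1_v$, $1_n\otimes_h 1_m\mapsto 1_{n+m}$; $\mathbf 1_h\to\mathbf 1_v$, $1_0\mapsto 1_0$. A duoidal category (or 2-monoidal category) is a category $\mathcal C$ with a monoidal structure $(\otimes_h,E_h)$ and a second monoidal structure $(\boxtimes,E_v)$ such that the functors $\boxtimes:\mathcal C\times\mathcal C\to\mathcal C$ and $E_v:1\to\mathcal C$ (from the terminal category) are lax monoidal with respect to $(\otimes_h,E_h)$, and such that the coherence isomorphisms (associator and unitors) of $(\boxtimes,E_v)$ are monoidal natural transformations with respect to $(\otimes_h,E_h)$. The lax structure thus consists of a natural transformation $(C_1\boxtimes C_2)\otimes_h(C_3\boxtimes C_4)\to(C_1\otimes_h C_3)\boxtimes(C_2\otimes_h C_4)$ together with morphisms $E_h\to E_h\boxtimes E_h$, $E_v\otimes_h E_v\to E_v$, $E_h\to E_v$. *)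

(* Defs.v *)
From HB Require Import structures.
From mathcomp Require Import all_boot all_algebra.
From mathcomp Require Import boolp classical_sets functions cardinality fsbigop.
From mathcomp Require Import reals complex freeg.

Set Implicit Arguments.
Unset Strict Implicit.
Unset Printing Implicit Defensive.

Import GRing.Theory.
Local Open Scope classical_set_scope.
Local Open Scope ring_scope.
Local Open Scope quotient_scope.

(* Categories, functors, monoidal structures and lax structures are records of
   data; the axioms are the predicates is_category, is_functor, is_monoidal,
   is_lax_monoidal, etc. on these data. *)

Record cat_data := CatData {
  ob :> Type;
  hom : ob -> ob -> Type;
  idm : forall a, hom a a;
  compm : forall a b c, hom b c -> hom a b -> hom a c
}.
Arguments hom {_}.
Arguments idm {_} a.
Arguments compm {_ _ _ _}.

Notation "g \oc f" := (compm g f) (at level 50, left associativity).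

Record is_category (C : cat_data) : Prop := {
  comp_idl : forall (a b : C) (f : hom a b), idm b \oc f = f;
  comp_idr : forall (a b : C) (f : hom a b), f \oc idm a = f;
  comp_assoc : forall (a b c d : C) (h : hom c d) (g : hom b c) (f : hom a b),
    h \oc (g \oc f) = (h \oc g) \oc f
}.

Definition is_iso (C : cat_data) (a b : C) (f : hom a b) : Prop :=
  exists2 g : hom b a, g \oc f = idm a & f \oc g = idm b.

Definition prod_cat (C D : cat_data) : cat_data :=
  @CatData (C * D)%type (fun x y => (hom x.1 y.1 * hom x.2 y.2)%type)
    (fun x => (idm x.1, idm x.2))
    (fun x y z g f => (g.1 \oc f.1, g.2 \oc f.2)).

Definition one_cat : cat_data :=
  @CatData unit (fun _ _ => unit) (fun=> tt) (fun _ _ _ _ _ => tt).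

Record functor_data (C D : cat_data) := FunctorData {
  fob :> C -> D;
  fmor : forall a b, hom a b -> hom (fob a) (fob b)
}.
Arguments fmor {C D} f {a b}.

Record is_functor (C D : cat_data) (F : functor_data C D) : Prop := {
  fmor_id : forall a, fmor F (idm a) = idm (F a);
  fmor_comp : forall (a b c : C) (g : hom b c) (f : hom a b),
    fmor F (g \oc f) = fmor F g \oc fmor F f
}.

Definition is_natural (C D : cat_data) (F G : functor_data C D)
    (t : forall a, hom (F a) (G a)) : Prop :=
  forall (a b : C) (f : hom a b), fmor G f \oc t a = t b \oc fmor F f.

Definition id_functor (C : cat_data) : functor_data C C :=
  @FunctorData C C id (fun _ _ f => f).

Definition comp_functor (C D E : cat_data) (G : functor_data D E)
    (F : functor_data C D) : functor_data C E :=
  @FunctorData C E (fun a => G (F a)) (fun _ _ f => fmor G (fmor F f)).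

Definition pair_functor (C D E : cat_data) (F : functor_data C D)
    (G : functor_data C E) : functor_data C (prod_cat D E) :=
  @FunctorData C (prod_cat D E) (fun a => (F a, G a))
    (fun _ _ f => (fmor F f, fmor G f)).

Definition fst_functor (C D : cat_data) : functor_data (prod_cat C D) C :=
  @FunctorData (prod_cat C D) C fst (fun _ _ f => f.1).

Definition snd_functor (C D : cat_data) : functor_data (prod_cat C D) D :=
  @FunctorData (prod_cat C D) D snd (fun _ _ f => f.2).

Definition bang_functor (C : cat_data) : functor_data C one_cat :=
  @FunctorData C one_cat (fun=> tt) (fun _ _ _ => tt).

Definition point_functor (C : cat_data) (e : C) : functor_data one_cat C :=
  @FunctorData one_cat C (fun=> e) (fun _ _ _ => idm e).

Record monoidal_data (C : cat_data) := MonoidalData {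
  mob : C -> C -> C;
  mmor : forall a a' b b', hom a a' -> hom b b' -> hom (mob a b) (mob a' b');
  munit : C;
  massoc : forall a b c, hom (mob (mob a b) c) (mob a (mob b c));
  mlunit : forall a, hom (mob munit a) a;
  mrunit : forall a, hom (mob a munit) a
}.
Arguments mmor {C} m {a a' b b'}.
Arguments munit {C} m.

Section Monoidal.
Variables (C : cat_data) (M : monoidal_data C).

Definition tensor_functor : functor_data (prod_cat C C) C :=
  @FunctorData (prod_cat C C) C (fun x => mob M x.1 x.2)
    (fun _ _ f => mmor M f.1 f.2).

(* Point-free so that it inherits a lax structure by composition:
   (a, b, c) |-> (a (x) b) (x) c. *)
Definition tensor3l : functor_data (prod_cat (prod_cat C C) C) C :=
  comp_functor tensor_functor
    (pair_functor (comp_functor tensor_functor (fst_functor _ _))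
                  (snd_functor _ _)).

(* (a, b, c) |-> a (x) (b (x) c). *)
Definition tensor3r : functor_data (prod_cat (prod_cat C C) C) C :=
  comp_functor tensor_functor
    (pair_functor (comp_functor (fst_functor _ _) (fst_functor _ _))
       (comp_functor tensor_functor
          (pair_functor (comp_functor (snd_functor _ _) (fst_functor _ _))
                        (snd_functor _ _)))).

(* a |-> 1 (x) a. *)
Definition tensor1l : functor_data C C :=
  comp_functor tensor_functor
    (pair_functor (comp_functor (point_functor (munit M)) (bang_functor C))
                  (id_functor C)).

(* a |-> a (x) 1. *)
Definition tensor1r : functor_data C C :=
  comp_functor tensor_functor
    (pair_functor (id_functor C)
                  (comp_functor (point_functor (munit M)) (bang_functor C))).

Definition assoc_trans (x : prod_cat (prod_cat C C) C) :
  hom (tensor3l x) (tensor3r x) := massoc M x.1.1 x.1.2 x.2.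
Definition lunit_trans (a : C) : hom (tensor1l a) (id_functor C a) :=
  mlunit M a.
Definition runit_trans (a : C) : hom (tensor1r a) (id_functor C a) :=
  mrunit M a.

Record is_monoidal : Prop := {
  tensor_functorP : is_functor tensor_functor;
  massoc_natural : is_natural assoc_trans;
  mlunit_natural : is_natural lunit_trans;
  mrunit_natural : is_natural runit_trans;
  massoc_iso : forall a b c, is_iso (massoc M a b c);
  mlunit_iso : forall a, is_iso (mlunit M a);
  mrunit_iso : forall a, is_iso (mrunit M a);
  mpentagon : forall a b c d,
    massoc M a b (mob M c d) \oc massoc M (mob M a b) c d =
    mmor M (idm a) (massoc M b c d) \oc massoc M a (mob M b c) d
      \oc mmor M (massoc M a b c) (idm d);
  mtriangle : forall a b,
    mmor M (idm a) (mlunit M b) \oc massoc M a (munit M) b =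
    mmor M (mrunit M a) (idm b)
}.
End Monoidal.

Definition prod_monoidal (C D : cat_data) (M : monoidal_data C)
    (N : monoidal_data D) : monoidal_data (prod_cat C D) :=
  @MonoidalData (prod_cat C D)
    (fun x y => (mob M x.1 y.1, mob N x.2 y.2))
    (fun _ _ _ _ f g => (mmor M f.1 g.1, mmor N f.2 g.2))
    (munit M, munit N)
    (fun x y z => (massoc M x.1 y.1 z.1, massoc N x.2 y.2 z.2))
    (fun x => (mlunit M x.1, mlunit N x.2))
    (fun x => (mrunit M x.1, mrunit N x.2)).

Definition one_monoidal : monoidal_data one_cat :=
  @MonoidalData one_cat (fun _ _ => tt) (fun _ _ _ _ _ _ => tt) tt
    (fun _ _ _ => tt) (fun=> tt) (fun=> tt).

Record lax_data (C D : cat_data) (M : monoidal_data C) (N : monoidal_data D)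
    (F : functor_data C D) := LaxData {
  lax_mu : forall a b : C, hom (mob N (F a) (F b)) (F (mob M a b));
  lax_eta : hom (munit N) (F (munit M))
}.
Arguments lax_mu {C D M N F}.
Arguments lax_eta {C D M N F}.

Record is_lax_monoidal (C D : cat_data) (M : monoidal_data C)
    (N : monoidal_data D) (F : functor_data C D) (l : lax_data M N F) :
    Prop := {
  lax_functor : is_functor F;
  lax_mu_natural : forall (a a' b b' : C) (f : hom a a') (g : hom b b'),
    fmor F (mmor M f g) \oc lax_mu l a b =
    lax_mu l a' b' \oc mmor N (fmor F f) (fmor F g);
  lax_assoc : forall a b c : C,
    fmor F (massoc M a b c) \oc lax_mu l (mob M a b) c
      \oc mmor N (lax_mu l a b) (idm (F c)) =
    lax_mu l a (mob M b c) \oc mmor N (idm (F a)) (lax_mu l b c)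
      \oc massoc N (F a) (F b) (F c);
  lax_lunit : forall a : C,
    fmor F (mlunit M a) \oc lax_mu l (munit M) a
      \oc mmor N (lax_eta l) (idm (F a)) = mlunit N (F a);
  lax_runit : forall a : C,
    fmor F (mrunit M a) \oc lax_mu l a (munit M)
      \oc mmor N (idm (F a)) (lax_eta l) = mrunit N (F a)
}.

Record is_monoidal_natural (C D : cat_data) (M : monoidal_data C)
    (N : monoidal_data D) (F G : functor_data C D) (lF : lax_data M N F)
    (lG : lax_data M N G) (t : forall a, hom (F a) (G a)) : Prop := {
  monoidal_natural : is_natural t;
  monoidal_natural_mu : forall a b : C,
    t (mob M a b) \oc lax_mu lF a b = lax_mu lG a b \oc mmor N (t a) (t b);
  monoidal_natural_eta : t (munit M) \oc lax_eta lF = lax_eta lG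
}.

Section LaxFunctors.
Variables (C D E : cat_data).
Variables (M : monoidal_data C) (N : monoidal_data D) (L : monoidal_data E).

Definition lax_id : lax_data M M (id_functor C) :=
  @LaxData C C M M (id_functor C) (fun a b => idm (mob M a b)) (idm (munit M)).

Definition lax_comp (G : functor_data D E) (F : functor_data C D)
    (lG : lax_data N L G) (lF : lax_data M N F) :
    lax_data M L (comp_functor G F) :=
  @LaxData C E M L (comp_functor G F)
    (fun a b => fmor G (lax_mu lF a b) \oc lax_mu lG (F a) (F b))
    (fmor G (lax_eta lF) \oc lax_eta lG).

Definition lax_pair (F : functor_data C D) (G : functor_data C E)
    (lF : lax_data M N F) (lG : lax_data M L G) :
    lax_data M (prod_monoidal N L) (pair_functor F G) :=
  @LaxData C (prod_cat D E) M (prod_monoidal N L) (pair_functor F G)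
    (fun a b => (lax_mu lF a b, lax_mu lG a b)) (lax_eta lF, lax_eta lG).

Definition lax_fst : lax_data (prod_monoidal M N) M (fst_functor C D) :=
  @LaxData (prod_cat C D) C (prod_monoidal M N) M (fst_functor C D)
    (fun x y => idm (mob M x.1 y.1)) (idm (munit M)).

Definition lax_snd : lax_data (prod_monoidal M N) N (snd_functor C D) :=
  @LaxData (prod_cat C D) D (prod_monoidal M N) N (snd_functor C D)
    (fun x y => idm (mob N x.2 y.2)) (idm (munit N)).

Definition lax_bang : lax_data M one_monoidal (bang_functor C) :=
  @LaxData C one_cat M one_monoidal (bang_functor C) (fun _ _ => tt) tt.
End LaxFunctors.

Section Duoidal.
Variables (C : cat_data) (H V : monoidal_data C).
(* Lax structures, with respect to H, on the tensor product functor
   C x C -> C and on the unit functor 1 -> C of V. *)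
Variables (lV : lax_data (prod_monoidal H H) H (tensor_functor V)).
Variables (lE : lax_data one_monoidal H (point_functor (munit V))).

Definition lax_tensor3l :
    lax_data (prod_monoidal (prod_monoidal H H) H) H (tensor3l V) :=
  lax_comp lV (lax_pair (lax_comp lV (lax_fst _ _)) (lax_snd _ _)).

Definition lax_tensor3r :
    lax_data (prod_monoidal (prod_monoidal H H) H) H (tensor3r V) :=
  lax_comp lV
    (lax_pair (lax_comp (lax_fst _ _) (lax_fst _ _))
       (lax_comp lV (lax_pair (lax_comp (lax_snd _ _) (lax_fst _ _))
                              (lax_snd _ _)))).

Definition lax_tensor1l : lax_data H H (tensor1l V) :=
  lax_comp lV (lax_pair (lax_comp lE (lax_bang H)) (lax_id H)).

Definition lax_tensor1r : lax_data H H (tensor1r V) :=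
  lax_comp lV (lax_pair (lax_id H) (lax_comp lE (lax_bang H))).

Record is_duoidal : Prop := {
  duoidal_category : is_category C;
  duoidal_h : is_monoidal H;
  duoidal_v : is_monoidal V;
  duoidal_tensor : is_lax_monoidal lV;
  duoidal_unit : is_lax_monoidal lE;
  duoidal_assoc : is_monoidal_natural lax_tensor3l lax_tensor3r (assoc_trans V);
  duoidal_lunit : is_monoidal_natural lax_tensor1l (lax_id H) (lunit_trans V);
  duoidal_runit : is_monoidal_natural lax_tensor1r (lax_id H) (runit_trans V)
}.
End Duoidal.
Arguments is_duoidal : clear implicits.

Notation bilinear_map f := (bilinear_for *:%R *:%R f).

Section Tensor.
Variables (K : fieldType) (V W : lmodType K).

Local Notation free := {freeg (V * W)%type / K}.

(* The subspace of the free vector space on V x W by which one quotients to get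
   the tensor product. *)
Inductive tensor_rel : free -> Prop :=
| tensor_rel0 : tensor_rel 0
| tensor_relB x y : tensor_rel x -> tensor_rel y -> tensor_rel (x - y)
| tensor_relZ a x : tensor_rel x -> tensor_rel (a *: x)
| tensor_rel_linl a v v' w :
    tensor_rel (<< (a *: v + v', w) >> - (a *: << (v, w) >> + << (v', w) >>))
| tensor_rel_linr a v w w' :
    tensor_rel (<< (v, a *: w + w') >> - (a *: << (v, w) >> + << (v, w') >>)).

Definition tensor_pred : {pred free} := fun x => `[< tensor_rel x >].

Lemma tensor_pred_zmod : zmod_closed tensor_pred.
Proof.
split=> [|x y]; first by apply/asboolP; exact: tensor_rel0.
by move=> /asboolP rx /asboolP ry; apply/asboolP; exact: tensor_relB.
Qed.
HB.instance Definition _ := GRing.isZmodClosed.Build free tensor_pred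
  tensor_pred_zmod.

Definition tensor : Type := @Quotient.quot free tensor_pred.

HB.instance Definition _ := GRing.Zmodule.on tensor.

Let tpi (x : free) : tensor := \pi_(@Quotient.quot free tensor_pred) x.

Let tpi_eq x y : (tpi x = tpi y) <-> tensor_rel (x - y).
Proof.
rewrite /tpi; split=> [e|r].
  by apply/asboolP; change (x - y \in tensor_pred);
     rewrite Quotient.idealrBE e eqxx.
by apply/eqP; rewrite -Quotient.idealrBE; exact/asboolP.
Qed.

Let tpiB x y : tpi (x - y) = tpi x - tpi y.
Proof. by rewrite /tpi !piE. Qed.
Let tpiD x y : tpi (x + y) = tpi x + tpi y.
Proof. by rewrite /tpi !piE. Qed.

Let tscale a (t : tensor) : tensor := tpi (a *: repr t).

Let tscale_pi a x : tscale a (tpi x) = tpi (a *: x).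
Proof.
apply/tpi_eq; rewrite -scalerBr; apply: tensor_relZ; apply/tpi_eq.
by rewrite /tpi reprK.
Qed.

Let tscaleA a b t : tscale a (tscale b t) = tscale (a * b) t.
Proof. by elim/quotW: t => x; rewrite -/(tpi x) !tscale_pi scalerA. Qed.
Let tscale1 t : tscale 1 t = t.
Proof. by elim/quotW: t => x; rewrite -/(tpi x) !tscale_pi scale1r. Qed.
Let tscaleDr a t u : tscale a (t + u) = tscale a t + tscale a u.
Proof.
elim/quotW: t => x; elim/quotW: u => y; rewrite -/(tpi x) -/(tpi y).
by rewrite -tpiD !tscale_pi scalerDr tpiD.
Qed.
Let tscaleDl t a b : tscale (a + b) t = tscale a t + tscale b t.
Proof.
by elim/quotW: t => x; rewrite -/(tpi x) !tscale_pi scalerDl tpiD.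
Qed.
HB.instance Definition _ := GRing.Zmodule_isLmodule.Build K tensor
  tscaleA tscale1 tscaleDr tscaleDl.

Definition tpure (v : V) (w : W) : tensor := tpi << (v, w) >>.

Let tpi_linear a x y : tpi (a *: x + y) = a *: tpi x + tpi y.
Proof. by rewrite tpiD -tscale_pi. Qed.

Lemma tpure_bilinear : bilinear_map tpure.
Proof.
split=> [w|v] a x y /=; rewrite /tpure -tpi_linear; apply/tpi_eq.
- exact: tensor_rel_linl.
- exact: tensor_rel_linr.
Qed.

Lemma tensor_ind (P : tensor -> Prop) :
  P 0 -> (forall t u, P t -> P u -> P (t + u)) -> (forall v w, P (tpure v w)) ->
  forall t, P t.
Proof.
move=> P0 PD Pp; elim/quotW=> x; rewrite -/(tpi x) -[x]freeg_sumE.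
elim: (dom x) => [|vw s IHs].
  by rewrite big_nil -[0](subrr 0) tpiB subrr.
rewrite big_cons tpiD; apply: PD => //.
have -> : << coeff vw x *g vw >> = coeff vw x *: << vw >> :> free.
  by apply/eqP/freeg_eqP => k; rewrite coeffZ !coeffU mul1r.
rewrite -[_ *: _]addr0 tpi_linear -[0](subrr 0) tpiB subrr addr0.
case: vw {s IHs} => v w; rewrite -/(tpure v w).
have /= := tpure_bilinear.1 w (coeff (v, w) x) v 0.
have /= := tpure_bilinear.1 w (-1) 0 0.
by rewrite scaleN1r oppr0 addr0 scaleN1r addNr => -> ; rewrite !addr0 => <-.
Qed.

Section Lift.
Variables (U : lmodType K) (f : V -> W -> U).

Definition tlift_fun of bilinear_map f := fun t : tensor =>
  fglift (fun vw => f vw.1 vw.2) (repr t).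

Hypothesis fB : bilinear_map f.

Let ev := fglift (fun vw : V * W => f vw.1 vw.2).

Let ev_linear : linear ev.
Proof.
have evB : {morph ev : x y / x - y}.
  move=> x y; exact: lift_is_additive.
have ev0 : ev 0 = 0 by rewrite -[0](subrr 0) evB subrr.
have evN x : ev (- x) = - ev x by rewrite -[- x]sub0r evB ev0 sub0r.
have evD : {morph ev : x y / x + y}.
  by move=> x y; rewrite -[y]opprK evB !evN.
move=> a x y; rewrite evD; congr (_ + _).
rewrite -[x]freeg_sumE scaler_sumr !(big_morph _ evD ev0) scaler_sumr.
apply: eq_bigr => k _.
have -> : a *: << coeff k x *g k >> = << a * coeff k x *g k >> :> free.
  by apply/eqP/freeg_eqP => j; rewrite coeffZ !coeffU mulrA.
by rewrite /ev !liftU scalerA.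
Qed.

Let ev_rel x : tensor_rel x -> ev x = 0.
Proof.
have evD x1 y1 : ev (x1 + y1) = ev x1 + ev y1.
  by have := ev_linear 1 x1 y1; rewrite !scale1r.
have ev0 : ev 0 = 0 by apply: (addrI (ev 0)); rewrite -evD !addr0.
have evZ a x1 : ev (a *: x1) = a *: ev x1.
  by have := ev_linear a x1 0; rewrite ev0 !addr0.
have evN x1 : ev (- x1) = - ev x1.
  by rewrite -[in LHS](scaleN1r x1) evZ scaleN1r.
elim=> // [x1 y1 _ IHx _ IHy|a x1 _ IHx|a v v' w|a v w w'].
- by rewrite evD evN IHx IHy subrr.
- by rewrite evZ IHx scaler0.
- rewrite evD evN evD evZ /ev !liftU /= !scale1r.
  by have /= -> := fB.1 w a v v'; rewrite subrr.
- rewrite evD evN evD evZ /ev !liftU /= !scale1r.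
  by have /= -> := fB.2 v a w w'; rewrite subrr.
Qed.

Let tlift_pi x : tlift_fun fB (tpi x) = ev x.
Proof.
have /tpi_eq/ev_rel : tpi (repr (tpi x)) = tpi x by rewrite /tpi reprK.
by rewrite addrC -[X in X + _]scaleN1r ev_linear scaleN1r => /eqP;
   rewrite addrC subr_eq0 => /eqP.
Qed.

Lemma tlift_is_linear : linear (tlift_fun fB).
Proof.
move=> a t u; elim/quotW: t => x; elim/quotW: u => y.
by rewrite -/(tpi x) -/(tpi y) -tpi_linear !tlift_pi ev_linear.
Qed.
HB.instance Definition _ := GRing.isLinear.Build K tensor U *:%R
  (tlift_fun fB) tlift_is_linear.

Lemma tlift_pure v w : tlift_fun fB (tpure v w) = f v w.
Proof. by rewrite tlift_pi /ev liftU scale1r. Qed.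
End Lift.

End Tensor.
Definition tlift (K : fieldType) (V W U : lmodType K) (f : V -> W -> U)
  (fB : bilinear_map f) : {linear tensor V W -> U} := tlift_fun fB.

Section DirectSum.
Variables (K : fieldType) (I : choiceType) (V : I -> lmodType K).

(* Finitely supported families. *)
Record dsum := DSum {
  dsum_coord :> forall i, V i;
  dsum_finite : finite_set [set i | dsum_coord i != 0]
}.

Lemma dsumP (x y : dsum) : (forall i, x i = y i) -> x = y.
Proof.
case: x y => [x xF] [y yF] /= xy.
have {}xy : x = y by exact: functional_extensionality_dep.
by subst y; congr DSum; exact: Prop_irrelevance.
Qed.

HB.instance Definition _ := gen_eqMixin dsum.
HB.instance Definition _ := gen_choiceMixin dsum.

Let zero_finite : finite_set [set i | (0 : V i) != 0].
Proof. by apply: (sub_finite_set _ (finite_set0 I)) => i /=; rewrite eqxx. Qed.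
Let opp_finite (x : dsum) : finite_set [set i | - x i != 0].
Proof.
by apply: (sub_finite_set _ (dsum_finite x)) => i /=; rewrite oppr_eq0.
Qed.
Let add_finite (x y : dsum) : finite_set [set i | x i + y i != 0].
Proof.
have xyF : finite_set ([set i | x i != 0] `|` [set i | y i != 0]).
  by rewrite finite_setU; split; exact: dsum_finite.
apply: (sub_finite_set _ xyF) => i /=.
by have [->|] := eqVneq (x i) 0; [rewrite add0r; right|left].
Qed.
Let scale_finite a (x : dsum) : finite_set [set i | a *: x i != 0].
Proof.
apply: (sub_finite_set _ (dsum_finite x)) => i /=.
by apply: contraNneq => ->; rewrite scaler0.
Qed.

Let dzero := DSum zero_finite.
Let dopp x := DSum (opp_finite x).
Let dadd x y := DSum (add_finite x y).
Let dscale a x := DSum (scale_finite a x).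

Let daddA : associative dadd.
Proof. by move=> x y z; apply: dsumP => i /=; rewrite addrA. Qed.
Let daddC : commutative dadd.
Proof. by move=> x y; apply: dsumP => i /=; rewrite addrC. Qed.
Let dadd0 : left_id dzero dadd.
Proof. by move=> x; apply: dsumP => i /=; rewrite add0r. Qed.
Let daddN : left_inverse dzero dopp dadd.
Proof. by move=> x; apply: dsumP => i /=; rewrite addNr. Qed.
HB.instance Definition _ := GRing.isZmodule.Build dsum daddA daddC dadd0 daddN.

Let dscaleA a b x : dscale a (dscale b x) = dscale (a * b) x.
Proof. by apply: dsumP => i /=; rewrite scalerA. Qed.
Let dscale1 x : dscale 1 x = x.
Proof. by apply: dsumP => i /=; rewrite scale1r. Qed.
Let dscaleDr a x y : dscale a (x + y) = dscale a x + dscale a y.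
Proof. by apply: dsumP => i /=; rewrite scalerDr. Qed.
Let dscaleDl x a b : dscale (a + b) x = dscale a x + dscale b x.
Proof. by apply: dsumP => i /=; rewrite scalerDl. Qed.
HB.instance Definition _ := GRing.Zmodule_isLmodule.Build K dsum
  dscaleA dscale1 dscaleDr dscaleDl.

Definition dinj_coord i (v : V i) j : V j :=
  if eqP is ReflectT e then ecast k (V k) e v else 0.

Lemma dinj_finite i (v : V i) : finite_set [set j | @dinj_coord i v j != 0].
Proof.
apply: (sub_finite_set _ (finite_set1 i)) => j /=; rewrite /dinj_coord.
by case: eqP => [/esym//|_]; rewrite eqxx.
Qed.

Definition dinj_fun i (v : V i) : dsum := DSum (dinj_finite v).

Lemma dinjE i (v : V i) : dinj_fun v i = v.
Proof. by rewrite /= /dinj_coord; case: eqP => // e; rewrite eq_axiomK. Qed.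

Lemma dinjN i (v : V i) j : i != j -> dinj_fun v j = 0.
Proof. by rewrite /= /dinj_coord; case: eqP. Qed.

Lemma dinj_is_linear i : linear (@dinj_fun i).
Proof.
move=> a v w; apply: dsumP => j /=; rewrite /dinj_coord.
by case: eqP => [e|_]; [case: j / e|rewrite scaler0 addr0].
Qed.
HB.instance Definition _ i := GRing.isLinear.Build K (V i) dsum *:%R
  (@dinj_fun i) (@dinj_is_linear i).
Definition dinj i : {linear V i -> dsum} := @dinj_fun i.

Lemma dsum_supp (x : dsum) :
  exists2 s : seq I, uniq s & forall i, i \notin s -> x i = 0.
Proof.
have /finite_seqP[s xs] := dsum_finite x.
exists (undup s) => [|i]; first exact: undup_uniq.
rewrite mem_undup => /negP si; apply: contrapT => /eqP xi; apply: si.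
by have : [set` s] i by rewrite -xs.
Qed.

Lemma dsum_ind (P : dsum -> Prop) :
  P 0 -> (forall x y, P x -> P y -> P (x + y)) ->
  (forall i (v : V i), P (dinj i v)) -> forall x, P x.
Proof.
move=> P0 PD Pi x; have [s us] := dsum_supp x.
elim: s us x => [_ x x0|j s IHs /= /andP[js us] x xs].
  by suff -> : x = 0 by []; apply: dsumP => i; rewrite x0.
rewrite -[x](subrK (dinj j (x j))); apply: PD; last exact: Pi.
apply: IHs => // i si.
have -> : (x - dinj j (x j)) i = x i - dinj_fun (x j) i by [].
have [<-|ji] := eqVneq j i; first by rewrite dinjE subrr.
by rewrite dinjN // subr0 xs // inE eq_sym negb_or ji.
Qed.

Section Lift.
Variables (U : lmodType K) (f : forall i, {linear V i -> U}).

Definition dlift_fun (x : dsum) : U := \sum_(i \in [set: I]) f i (x i).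

Let dlift_seq (x : dsum) s : uniq s -> (forall i, i \notin s -> x i = 0) ->
  dlift_fun x = \sum_(i <- s) f i (x i).
Proof.
move=> us xs; rewrite /dlift_fun (fsbigE s) //=.
  by apply: eq_bigl => i; rewrite in_setT.
by move=> i _ si; rewrite xs // linear0.
Qed.

Lemma dlift_is_linear : linear dlift_fun.
Proof.
move=> a x y; have [s us xs] := dsum_supp x; have [t ut yt] := dsum_supp y.
pose r := undup (s ++ t).
have rP (z : dsum) : (forall i, i \notin s -> i \notin t -> z i = 0) ->
    dlift_fun z = \sum_(i <- r) f i (z i).
  move=> zr; apply: dlift_seq => [|i]; first exact: undup_uniq.
  by rewrite mem_undup mem_cat negb_or => /andP[si ti]; exact: zr.
rewrite (rP x) => [|i si _]; last exact: xs.
rewrite (rP y) => [|i _ ti]; last exact: yt.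
rewrite rP => [|i si ti]; last first.
  by change (a *: x i + y i = 0); rewrite (xs i si) (yt i ti) scaler0 addr0.
rewrite scaler_sumr -big_split; apply: eq_bigr => i _ /=.
by rewrite -linearP.
Qed.
HB.instance Definition _ := GRing.isLinear.Build K dsum U *:%R
  dlift_fun dlift_is_linear.

Lemma dlift_inj i v : dlift_fun (dinj i v) = f i v.
Proof.
rewrite (@dlift_seq _ [:: i]) ?big_seq1 ?dinjE // => j.
by rewrite inE eq_sym => /(dinjN v).
Qed.
End Lift.
End DirectSum.

Definition dlift (K : fieldType) (I : choiceType) (V : I -> lmodType K)
  (U : lmodType K) (f : forall i, {linear V i -> U}) : {linear dsum V -> U} :=
  dlift_fun f.
Arguments dinj {K I V} i.

Lemma linear_ext (K : fieldType) (V U : lmodType K) (f g : {linear V -> U}) :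
  f =1 g -> f = g.
Proof.
case: f g => [f fP] [g gP] /= /funext fg; subst g; congr GRing.Linear.Pack.
case: fP gP => [[a] [b]] [[c] [d]].
by rewrite (Prop_irrelevance a c) (Prop_irrelevance b d).
Qed.

Section SumOfTensors.
Variables (K : fieldType) (I : choiceType) (V W : I -> lmodType K).

Definition tsum : lmodType K := dsum (fun i => tensor (V i) (W i)).

Definition spure i (v : V i) (w : W i) : tsum := dinj i (tpure v w).

Lemma spure_bilinear i : bilinear_map (@spure i).
Proof.
split=> [w|v] a x y /=; rewrite /spure.
- by have /= -> := (tpure_bilinear _ _).1 w a x y; rewrite linearP.
- by have /= -> := (tpure_bilinear _ _).2 v a x y; rewrite linearP.
Qed.

Lemma tsum_ext (U : lmodType K) (f g : tsum -> U) :
  linear f -> linear g ->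
  (forall i v w, f (@spure i v w) = g (spure v w)) -> f =1 g.
Proof.
move=> fL gL fg.
have lin0 (h : tsum -> U) : linear h -> h 0 = 0.
  by move=> hL; have := hL (-1) 0 0; rewrite scaler0 addr0 scaleN1r addNr.
have linD (h : tsum -> U) x y : linear h -> h (x + y) = h x + h y.
  by move=> hL; have := hL 1 x y; rewrite !scale1r.
elim/dsum_ind => [|x y fgx fgy|i]; first by rewrite !lin0.
- by rewrite !linD // fgx fgy.
elim/tensor_ind => [|x y fgx fgy|v w]; last exact: fg.
- by rewrite linear0 !lin0.
- by rewrite linearD !linD // fgx fgy.
Qed.

Section Lift.
Variables (U : lmodType K) (f : forall i, V i -> W i -> U).
Hypothesis fB : forall i, bilinear_map (@f i).

Definition slift : {linear tsum -> U} := dlift (fun i => tlift (fB i)).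

Lemma slift_pure i (v : V i) (w : W i) : slift (spure v w) = f v w.
Proof. by rewrite /= dlift_inj /= tlift_pure. Qed.
End Lift.

(* Lifting a family of trilinear maps in two steps: the function space Z -> U
   carries the pointwise lmodType structure. *)
Section CurriedLift.
Variables (Z U : lmodType K) (f : forall i, V i -> W i -> Z -> U).
Hypothesis fB : forall i, bilinear_map (@f i).
Hypothesis fL : forall i v w, linear (@f i v w).

Lemma slift_curry_bilinear : bilinear_map (slift fB : tsum -> Z -> U).
Proof.
split=> [z|x] a; first by move=> x y /=; rewrite linearP.
move=> y z /=.
pose F1 := fun x => slift fB x (a *: y + z).
pose F2 := fun x => a *: slift fB x y + slift fB x z.
apply: (@tsum_ext _ F1 F2 _ _ _ x) => [b u v|b u v|i v w].
- by rewrite /F1 linearP.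
- have E t : slift fB (b *: u + v) t = b *: slift fB u t + slift fB v t.
    by rewrite linearP.
  by rewrite /F2 !E !scalerDr !scalerA [a * b]mulrC addrACA.
- by rewrite /F1 /F2 !slift_pure fL.
Qed.
End CurriedLift.
End SumOfTensors.
Arguments spure {K I V W} i v w.
Arguments slift {K I V W U f} fB.

Lemma bilinear_comp (K : fieldType) (V V' W W' U : lmodType K)
  (h : V' -> W' -> U) (f : {linear V -> V'}) (g : {linear W -> W'}) :
  bilinear_map h -> bilinear_map (fun v w => h (f v) (g w)).
Proof.
move=> hB; split=> [w|v] a x y /=; rewrite linearP.
- exact: hB.1.
- exact: hB.2.
Qed.

Definition smap (K : fieldType) (I : choiceType) (V W V' W' : I -> lmodType K)
  (f : forall i, {linear V i -> V' i}) (g : forall i, {linear W i -> W' i}) :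
  {linear tsum V W -> tsum V' W'} :=
  slift (fun i => bilinear_comp (f i) (g i) (@spure_bilinear _ _ V' W' i)).

Lemma smapE (K : fieldType) (I : choiceType) (V W V' W' : I -> lmodType K)
  (f : forall i, {linear V i -> V' i}) (g : forall i, {linear W i -> W' i})
  i (v : V i) (w : W i) :
  smap f g (spure i v w) = spure i (f i v) (g i w).
Proof. by rewrite /smap slift_pure. Qed.

Definition bicoll (K : fieldType) : Type := nat -> nat -> lmodType K.

Definition bihom (K : fieldType) (P Q : bicoll K) : Type :=
  forall n m, {linear P n m -> Q n m}.

Definition Coll2 (K : fieldType) : cat_data :=
  @CatData (bicoll K) (@bihom K)
    (fun P n m => (idfun : {linear P n m -> P n m}))
    (fun P Q S g f n m => (g n m \o f n m : {linear P n m -> S n m})).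

Section Transport.
Variables (K : fieldType) (P : bicoll K).

(* The identity of P(n, m) when (n', m') = (n, m), and 0 otherwise: bidegrees
   which are only provably equal occur in the unitors. *)
Definition transp_fun n m n' m' (p : P n m) : P n' m' :=
  if (n =P n') is ReflectT en then
    if (m =P m') is ReflectT em then
      ecast k (P n' k) em (ecast k (P k m) en p)
    else 0
  else 0.

Lemma transp_is_linear n m n' m' : linear (@transp_fun n m n' m').
Proof.
rewrite /transp_fun => a x y.
case: eqP => [en|_]; last by rewrite scaler0 addr0.
case: eqP => [em|_]; last by rewrite scaler0 addr0.
by subst n' m'.
Qed.
HB.instance Definition _ n m n' m' := GRing.isLinear.Build K (P n m) (P n' m')
  *:%R (@transp_fun n m n' m') (@transp_is_linear n m n' m').
Definition transp n m n' m' : {linear P n m -> P n' m'} :=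
  @transp_fun n m n' m'.

Lemma transp_id n m (p : P n m) : transp n m n m p = p.
Proof.
rewrite /= /transp_fun; case: eqP => // en; case: eqP => // em.
by rewrite !eq_axiomK.
Qed.
End Transport.
Arguments transp {K} P {n m n' m'}.

(* The space K if b holds and 0 otherwise, with its generator. *)
Section Kspace.
Variable K : fieldType.

Definition kspace (b : bool) : lmodType K :=
  if b then (K^o : lmodType K) else ('rV[K]_0 : lmodType K).

Definition kone (b : bool) : kspace b :=
  if b as b' return kspace b' then (1 : K^o) else 0.

Definition kcoef_fun (b : bool) : kspace b -> K^o :=
  if b as b' return kspace b' -> K^o then id else fun=> 0.

Lemma kcoef_is_linear b : linear (@kcoef_fun b).
Proof. by case: b => a x y //=; rewrite scaler0 addr0. Qed.
HB.instance Definition _ b := GRing.isLinear.Build K (kspace b) K^o *:%R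
  (@kcoef_fun b) (@kcoef_is_linear b).
Definition kcoef b : {linear kspace b -> K^o} := @kcoef_fun b.

Lemma kspaceE b (c : kspace b) : c = kcoef b c *: kone b.
Proof.
case: b c => c /=; last by apply/rowP; case.
by rewrite /GRing.scale /= mulr1.
Qed.

Lemma kcoef_one b : kcoef b (kone b) = b%:R.
Proof. by case: b. Qed.

Definition kmap_fun b (U : lmodType K) (u : U) (c : kspace b) : U :=
  kcoef b c *: u.

Lemma kmap_is_linear b (U : lmodType K) (u : U) : linear (@kmap_fun b U u).
Proof. by move=> a x y; rewrite /kmap_fun linearP scalerDl -scalerA. Qed.
HB.instance Definition _ b (U : lmodType K) (u : U) := GRing.isLinear.Build K
  (kspace b) U *:%R (@kmap_fun b U u) (@kmap_is_linear b U u).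
Definition kmap b (U : lmodType K) (u : U) : {linear kspace b -> U} :=
  @kmap_fun b U u.
End Kspace.
Arguments kone {K} b.
Arguments kcoef {K b}.
Arguments kmap {K} b {U} u.

Lemma kcoef_bilinear (K : fieldType) b (V U : lmodType K)
    (f : {linear V -> U}) :
  bilinear_map (fun (c : kspace K b) v => kcoef c *: f v).
Proof.
split=> [v|c] a x y /=.
- by rewrite linearP scalerDl -scalerA.
- by rewrite linearP scalerDr !scalerA mulrC.
Qed.

Lemma coefk_bilinear (K : fieldType) b (V U : lmodType K)
    (f : {linear V -> U}) :
  bilinear_map (fun v (c : kspace K b) => kcoef c *: f v).
Proof.
have [B1 B2] := kcoef_bilinear b f.
by split=> [c|v]; [exact: B2|exact: B1].
Qed.

Section Vertical.
Variable K : fieldType.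
Implicit Types P Q S : bicoll K.

Definition vtens P Q : bicoll K :=
  fun n m => tsum (fun k => P n k) (fun k => Q k m).

Definition vpure P Q n k m (p : P n k) (q : Q k m) : vtens P Q n m :=
  @spure _ _ (fun k => P n k) (fun k => Q k m) k p q.

Lemma vpure_bilinear P Q n k m : bilinear_map (@vpure P Q n k m).
Proof. exact: spure_bilinear. Qed.

Definition vmap P P' Q Q' (f : bihom P P') (g : bihom Q Q') :
    bihom (vtens P Q) (vtens P' Q') :=
  fun n m => smap (fun k => f n k) (fun k => g k m).

Lemma vmapE P P' Q Q' (f : bihom P P') (g : bihom Q Q') n k m
    (p : P n k) (q : Q k m) :
  vmap f g n m (vpure p q) = vpure (f n k p) (g k m q).
Proof. by rewrite /vmap /vpure smapE. Qed.

Definition vunit : bicoll K := fun n m => kspace K (n == m).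

Definition vone n : vunit n n := kone (n == n).

Section Assoc.
Variables (P Q S : bicoll K) (n m : nat).

Definition vassoc_pure k l (p : P n l) (q : Q l k) (s : S k m) :
  vtens P (vtens Q S) n m := vpure p (vpure q s).

Lemma vassoc_pure_bilinear k l : bilinear_map (@vassoc_pure k l).
Proof.
split=> [q|p] a x y; apply/funext => s; rewrite /vassoc_pure /=.
- exact: (vpure_bilinear _ _ _ _ _).1.
- by rewrite (vpure_bilinear _ _ _ _ _).1 (vpure_bilinear _ _ _ _ _).2.
Qed.

Lemma vassoc_pure_linear k l p q : linear (@vassoc_pure k l p q).
Proof.
move=> a x y; rewrite /vassoc_pure.
by rewrite (vpure_bilinear _ _ _ _ _).2 (vpure_bilinear _ _ _ _ _).2.
Qed.

Definition vassoc_at :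
    {linear vtens (vtens P Q) S n m -> vtens P (vtens Q S) n m} :=
  slift (fun k => slift_curry_bilinear (vassoc_pure_bilinear k)
                    (@vassoc_pure_linear k)).

Lemma vassocE k l (p : P n l) (q : Q l k) (s : S k m) :
  vassoc_at (vpure (vpure p q) s) = vpure p (vpure q s).
Proof. by rewrite /vassoc_at /vpure !slift_pure. Qed.
End Assoc.

Definition vassoc P Q S : bihom (vtens (vtens P Q) S) (vtens P (vtens Q S)) :=
  @vassoc_at P Q S.

(* 1_n (x) p |-> p: on the summand k the unit is zero unless k = n. *)
Definition vlunit P : bihom (vtens vunit P) P :=
  fun n m => slift (fun k => kcoef_bilinear (n == k) (@transp K P k m n m)).

Lemma vlunitE P n m (p : P n m) : vlunit P n m (vpure (vone n) p) = p.
Proof.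
by rewrite /vlunit /vpure slift_pure kcoef_one eqxx scale1r transp_id.
Qed.

Definition vrunit P : bihom (vtens P vunit) P :=
  fun n m => slift (fun k => coefk_bilinear (k == m) (@transp K P n k n m)).

Lemma vrunitE P n m (p : P n m) : vrunit P n m (vpure p (vone m)) = p.
Proof.
by rewrite /vrunit /vpure slift_pure kcoef_one eqxx scale1r transp_id.
Qed.
End Vertical.

(* The pairs of bidegrees (n1, m1), (n2, m2) with sum (n, m). *)
Definition bisplit (n m : nat) : choiceType :=
  {s : (nat * nat) * (nat * nat) |
    (s.1.1 + s.2.1 == n)%N && (s.1.2 + s.2.2 == m)%N}.

Lemma bisplit_proof n m n1 m1 n2 m2 : (n1 + n2 = n)%N -> (m1 + m2 = m)%N ->
  (n1 + n2 == n)%N && (m1 + m2 == m)%N.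
Proof. by move=> -> ->; rewrite !eqxx. Qed.

Definition Bisplit n m n1 m1 n2 m2 (en : (n1 + n2 = n)%N)
    (em : (m1 + m2 = m)%N) : bisplit n m :=
  exist _ ((n1, m1), (n2, m2)) (bisplit_proof en em).

Section Bisplit.
Variables (n m : nat) (s : bisplit n m).
Definition sn1 := (val s).1.1.
Definition sm1 := (val s).1.2.
Definition sn2 := (val s).2.1.
Definition sm2 := (val s).2.2.
Lemma bisplit_n : (sn1 + sn2 = n)%N.
Proof. by rewrite /sn1 /sn2; case/andP: (valP s) => /eqP. Qed.
Lemma bisplit_m : (sm1 + sm2 = m)%N.
Proof. by rewrite /sm1 /sm2; case/andP: (valP s) => _ /eqP. Qed.
End Bisplit.

Section Horizontal.
Variable K : fieldType.
Implicit Types P Q S : bicoll K.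

Definition htens P Q : bicoll K := fun n m =>
  tsum (fun s : bisplit n m => P (sn1 s) (sm1 s)) (fun s => Q (sn2 s) (sm2 s)).

Definition hpure P Q n m n1 m1 n2 m2 (en : (n1 + n2 = n)%N)
    (em : (m1 + m2 = m)%N) (p : P n1 m1) (q : Q n2 m2) : htens P Q n m :=
  @spure _ _ (fun s : bisplit n m => P (sn1 s) (sm1 s))
    (fun s => Q (sn2 s) (sm2 s)) (Bisplit en em) p q.

Lemma hpure_bilinear P Q n m n1 m1 n2 m2 en em :
  bilinear_map (@hpure P Q n m n1 m1 n2 m2 en em).
Proof.
exact: (@spure_bilinear K (bisplit n m) (fun s => P (sn1 s) (sm1 s))
  (fun s => Q (sn2 s) (sm2 s)) (Bisplit en em)).
Qed.

Definition hmap P P' Q Q' (f : bihom P P') (g : bihom Q Q') :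
    bihom (htens P Q) (htens P' Q') :=
  fun n m => smap (fun s => f (sn1 s) (sm1 s)) (fun s => g (sn2 s) (sm2 s)).

Lemma hmapE P P' Q Q' (f : bihom P P') (g : bihom Q Q') n m n1 m1 n2 m2
    (en : (n1 + n2 = n)%N) (em : (m1 + m2 = m)%N) (p : P n1 m1) (q : Q n2 m2) :
  hmap f g n m (hpure en em p q) = hpure en em (f n1 m1 p) (g n2 m2 q).
Proof. by rewrite /hmap /hpure smapE. Qed.

Definition hunit : bicoll K := fun n m => kspace K ((n == 0) && (m == 0))%N.

Definition hone : hunit 0%N 0%N := kone true.

Section Assoc.
Variables (P Q S : bicoll K) (n m : nat).

Lemma hassoc_subproof a b c d e : (a + b = d)%N -> (d + c = e)%N ->
  (a + (b + c) = e)%N.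
Proof. by move=> <- <-; rewrite addnA. Qed.

Definition hassoc_pure (s : bisplit n m) (t : bisplit (sn1 s) (sm1 s))
    (p : P (sn1 t) (sm1 t)) (q : Q (sn2 t) (sm2 t)) (r : S (sn2 s) (sm2 s)) :
    htens P (htens Q S) n m :=
  hpure (hassoc_subproof (bisplit_n t) (bisplit_n s))
        (hassoc_subproof (bisplit_m t) (bisplit_m s))
        p (hpure erefl erefl q r).

Lemma hassoc_pure_bilinear s t : bilinear_map (@hassoc_pure s t).
Proof.
split=> [q|p] a x y; apply/funext => r; rewrite /hassoc_pure /=.
- exact: (hpure_bilinear _ _ _ _).1.
- by rewrite (hpure_bilinear _ _ _ _).1 (hpure_bilinear _ _ _ _).2.
Qed.

Lemma hassoc_pure_linear s t p q : linear (@hassoc_pure s t p q).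
Proof.
move=> a x y; rewrite /hassoc_pure.
by rewrite (hpure_bilinear _ _ _ _).2 (hpure_bilinear _ _ _ _).2.
Qed.

Definition hassoc_at :
    {linear htens (htens P Q) S n m -> htens P (htens Q S) n m} :=
  slift (fun s => slift_curry_bilinear (@hassoc_pure_bilinear s)
                    (@hassoc_pure_linear s)).

Lemma hassocE n12 m12 n1 m1 n2 m2 n3 m3
    (en12 : (n1 + n2 = n12)%N) (em12 : (m1 + m2 = m12)%N)
    (en : (n12 + n3 = n)%N) (em : (m12 + m3 = m)%N)
    (en' : (n1 + (n2 + n3) = n)%N) (em' : (m1 + (m2 + m3) = m)%N)
    (p : P n1 m1) (q : Q n2 m2) (r : S n3 m3) :
  hassoc_at (hpure en em (hpure en12 em12 p q) r) =
  hpure en' em' p (hpure erefl erefl q r).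
Proof.
rewrite /hassoc_at {1}/hpure slift_pure {1}/hpure slift_pure /hassoc_pure.
by congr hpure; exact: eq_irrelevance.
Qed.
End Assoc.

Definition hassoc P Q S : bihom (htens (htens P Q) S) (htens P (htens Q S)) :=
  @hassoc_at P Q S.

Definition hlunit P : bihom (htens hunit P) P :=
  fun n m => slift (fun s : bisplit n m =>
    kcoef_bilinear ((sn1 s == 0) && (sm1 s == 0))%N
      (@transp K P (sn2 s) (sm2 s) n m)).

Lemma hlunitE P n m (p : P n m) :
  hlunit P n m (hpure (add0n n) (add0n m) hone p) = p.
Proof. by rewrite /hlunit /hpure slift_pure scale1r transp_id. Qed.

Definition hrunit P : bihom (htens P hunit) P :=
  fun n m => slift (fun s : bisplit n m =>
    coefk_bilinear ((sn2 s == 0) && (sm2 s == 0))%N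
      (@transp K P (sn1 s) (sm1 s) n m)).

Lemma hrunitE P n m (p : P n m) :
  hrunit P n m (hpure (addn0 n) (addn0 m) p hone) = p.
Proof. by rewrite /hrunit /hpure slift_pure scale1r transp_id. Qed.
End Horizontal.

Section Exchange.
Variable K : fieldType.

Section Exchange4.
Variables (C1 C2 C3 C4 : bicoll K) (n m : nat).

Section Pure.
Variable s : bisplit n m.

Definition exchange_pure k (p1 : C1 (sn1 s) k) (p2 : C2 k (sm1 s))
    l (p3 : C3 (sn2 s) l) (p4 : C4 l (sm2 s)) :
    vtens (htens C1 C3) (htens C2 C4) n m :=
  vpure (hpure (bisplit_n s) (erefl (k + l)%N) p1 p3)
        (hpure (erefl (k + l)%N) (bisplit_m s) p2 p4).

Lemma exchange_pure_bilinearr k p1 p2 l :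
  bilinear_map (@exchange_pure k p1 p2 l).
Proof.
split=> [p4|p3] a x y; rewrite /exchange_pure.
- by rewrite (hpure_bilinear _ _ _ _).2 (vpure_bilinear _ _ _ _ _).1.
- by rewrite (hpure_bilinear _ _ _ _).2 (vpure_bilinear _ _ _ _ _).2.
Qed.

Definition exchange_right k (p1 : C1 (sn1 s) k) (p2 : C2 k (sm1 s)) :
    vtens C3 C4 (sn2 s) (sm2 s) -> vtens (htens C1 C3) (htens C2 C4) n m :=
  slift (fun l => @exchange_pure_bilinearr k p1 p2 l).

Lemma exchange_right_bilinear k : bilinear_map (@exchange_right k).
Proof.
have comb (U U' : lmodType K) a (f g : {linear U -> U'}) :
    linear (fun u => a *: f u + g u).
  move=> b u v; rewrite (linearP f) (linearP g).
  by rewrite !scalerDr !scalerA [a * b]mulrC addrACA.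
split=> [p2|p1] a x y; apply/funext => z.
- apply: (@tsum_ext _ _ _ _ _ (exchange_right (a *: x + y) p2)
    (fun z => a *: exchange_right x p2 z + exchange_right y p2 z)).
  + exact: linearP.
  + exact: comb.
  move=> l p3 p4; rewrite /exchange_right !slift_pure /exchange_pure.
  by rewrite (hpure_bilinear _ _ _ _).1 (vpure_bilinear _ _ _ _ _).1.
- apply: (@tsum_ext _ _ _ _ _ (exchange_right p1 (a *: x + y))
    (fun z => a *: exchange_right p1 x z + exchange_right p1 y z)).
  + exact: linearP.
  + exact: comb.
  move=> l p3 p4; rewrite /exchange_right !slift_pure /exchange_pure.
  by rewrite (hpure_bilinear _ _ _ _).1 (vpure_bilinear _ _ _ _ _).2.
Qed.

Lemma exchange_right_linear k p1 p2 : linear (@exchange_right k p1 p2).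
Proof. exact: linearP. Qed.
End Pure.

Definition exchange_at : {linear htens (vtens C1 C2) (vtens C3 C4) n m ->
    vtens (htens C1 C3) (htens C2 C4) n m} :=
  slift (fun s => slift_curry_bilinear (@exchange_right_bilinear s)
                    (@exchange_right_linear s)).

Lemma exchangeE n1 n2 m1 m2 k l (en : (n1 + n2 = n)%N) (em : (m1 + m2 = m)%N)
    (p1 : C1 n1 k) (p2 : C2 k m1) (p3 : C3 n2 l) (p4 : C4 l m2) :
  exchange_at (hpure en em (vpure p1 p2) (vpure p3 p4)) =
  vpure (hpure en (erefl (k + l)%N) p1 p3) (hpure (erefl (k + l)%N) em p2 p4).
Proof.
rewrite /exchange_at {1}/hpure slift_pure {1}/vpure slift_pure.
rewrite /exchange_right {1}/vpure slift_pure /exchange_pure.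
by rewrite (eq_irrelevance (bisplit_n (Bisplit en em)) en)
           (eq_irrelevance (bisplit_m (Bisplit en em)) em).
Qed.
End Exchange4.

Definition exchange (C1 C2 C3 C4 : bicoll K) :
    bihom (htens (vtens C1 C2) (vtens C3 C4))
          (vtens (htens C1 C3) (htens C2 C4)) :=
  @exchange_at C1 C2 C3 C4.

(* Below, [kone b] is zero when [b] fails, but then so is the source. *)
Definition hunit_dup : bihom (hunit K) (vtens (hunit K) (hunit K)) :=
  fun n m => kmap _ (@vpure K (hunit K) (hunit K) n 0 m (kone _) (kone _)).

Lemma hunit_dupE : hunit_dup 0%N 0%N (hone K) = vpure (hone K) (hone K).
Proof. by rewrite /hunit_dup /= /kmap_fun scale1r. Qed.

Definition vunit_mul : bihom (htens (vunit K) (vunit K)) (vunit K) :=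
  fun n m => slift (fun s : bisplit n m =>
    kcoef_bilinear (sn1 s == sm1 s)
      (kmap (sn2 s == sm2 s) (kone (n == m)) : {linear _ -> vunit K n m})).

Lemma vunit_mulE n m :
  vunit_mul (n + m) (n + m) (hpure erefl erefl (vone K n) (vone K m)) =
  vone K (n + m).
Proof.
have E (k : nat) : (k == k)%:R = 1 :> K^o by rewrite eqxx.
rewrite /vunit_mul /hpure slift_pure /= /kmap_fun !kcoef_one.
by rewrite /sn1 /sm1 /sn2 /sm2 /= !E !scale1r.
Qed.

Definition hunit_vunit : bihom (hunit K) (vunit K) :=
  fun n m => kmap _ (kone (n == m)).

Lemma hunit_vunitE : hunit_vunit 0%N 0%N (hone K) = vone K 0.
Proof. by rewrite /hunit_vunit /= /kmap_fun scale1r. Qed.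
End Exchange.

Definition Coll2_h (K : fieldType) : monoidal_data (Coll2 K) :=
  @MonoidalData (Coll2 K) (@htens K) (@hmap K) (hunit K)
    (@hassoc K) (@hlunit K) (@hrunit K).

Definition Coll2_v (K : fieldType) : monoidal_data (Coll2 K) :=
  @MonoidalData (Coll2 K) (@vtens K) (@vmap K) (vunit K)
    (@vassoc K) (@vlunit K) (@vrunit K).

Definition Coll2_exchange (K : fieldType) :
    lax_data (prod_monoidal (Coll2_h K) (Coll2_h K)) (Coll2_h K)
      (tensor_functor (Coll2_v K)) :=
  @LaxData (prod_cat (Coll2 K) (Coll2 K)) (Coll2 K)
    (prod_monoidal (Coll2_h K) (Coll2_h K)) (Coll2_h K)
    (tensor_functor (Coll2_v K))
    (fun x y => @exchange K x.1 x.2 y.1 y.2) (@hunit_dup K).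

Definition Coll2_vunit (K : fieldType) :
    lax_data one_monoidal (Coll2_h K) (point_functor (munit (Coll2_v K))) :=
  @LaxData one_cat (Coll2 K) one_monoidal (Coll2_h K)
    (point_functor (munit (Coll2_v K)))
    (fun _ _ => @vunit_mul K) (@hunit_vunit K).

(* Main.v *)
Require Import Defs.
From HB Require Import structures.
From mathcomp Require Import all_boot all_algebra boolp functions reals complex.

(** The identities to be proved are equalities of families of linear maps out of
    iterated tensor products. Such a map is determined by its values on the
    pure tensors whose unit factors, if any, are the generators 1_0 or 1_n
    ([hgenP], [vgenP], [hunit_genP], [vunit_genP]), and on these each structure
    map has the explicit value by which it is described informally: the
    associators rebracket, the unitors erase a generator, and the exchange map
    swaps the two middle factors. Hence both sides of each axiom (the pentagon,
    the triangle, naturality, and the compatibilities of the exchange map with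
    the associators and the unitors) send a pure tensor to the same pure tensor.

    The only discrepancy left is one of bidegrees: a factor of degree
    (a + b) + c on one side may have degree a + (b + c) on the other, and these
    are not convertible. The degrees of the two factors of [hpure] are related
    to those of the tensor by propositional equalities, and eliminating these
    equalities identifies the two sides ([hpure_castr], [hpure_castl],
    [vpure_hpure]). In the same way, the unitors produce transports between
    provably equal degrees, which vanish ([hpure_transpr], [vpure_transp]).

    The associators are invertible because the opposite rebracketing is
    multilinear too, and hence defines a linear map in the other direction. *)

Set Implicit Arguments.
Unset Strict Implicit.
Unset Printing Implicit Defensive.

Import GRing.Theory.
Local Open Scope ring_scope.

(** * Spanning sets of vector spaces *)

(** [G] spans [V], in the form in which this is used: linear maps that agree on
    [G] are equal. *)
Definition spans (K : fieldType) (V : lmodType K) (G : V -> Prop) : Prop :=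
  forall (U : lmodType K) (f g : V -> U), linear f -> linear g ->
    (forall x, G x -> f x = g x) -> f =1 g.

Lemma spans_linear (K : fieldType) (V U : lmodType K) (G : V -> Prop)
    (f g : {linear V -> U}) :
  spans G -> (forall x, G x -> f x = g x) -> f =1 g.
Proof. by move=> sG; apply: (sG U f g); exact: linearP. Qed.

Lemma spans_bilinear (K : fieldType) (V W U : lmodType K) (G : V -> Prop)
    (H : W -> Prop) (b c : V -> W -> U) :
  spans G -> spans H -> bilinear_map b -> bilinear_map c ->
  (forall v w, G v -> H w -> b v w = c v w) -> forall v w, b v w = c v w.
Proof.
move=> sG sH [b1 b2] [c1 c2] bc v w.
apply: (sG _ (b^~ w) (c^~ w)) => {v} [||v Gv]; [exact: b1|exact: c1|].
by apply: (sH _ (b v) (c v)) => [||{}w Hw]; [exact: b2|exact: c2|exact: bc].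
Qed.

Lemma bilinear_postcomp (K : fieldType) (V W U T : lmodType K)
    (b : V -> W -> U) (f : U -> T) :
  bilinear_map b -> linear f -> bilinear_map (fun v w => f (b v w)).
Proof.
move=> [b1 b2] fL; split=> [w|v] a x y /=.
- by have /= -> := b1 w a x y; exact: fL.
- by have /= -> := b2 v a x y; exact: fL.
Qed.

Lemma bilinear_flip (K : fieldType) (V W U : lmodType K) (b : V -> W -> U) :
  bilinear_map b -> bilinear_map (fun w v => b v w).
Proof. by case=> b1 b2; split. Qed.

(** * Generators of tensor products *)

Section Generators.
Variable K : fieldType.
Implicit Types P Q S : bicoll K.

(** A set of elements of a bicollection, bidegree by bidegree. *)
Definition gens P := forall n m, P n m -> Prop.

(** [G] spans the bicollection in every bidegree. *)
Definition generates P (G : gens P) := forall n m, spans (@G n m).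

(** The value of a morphism of bicollections. Naming this application gives the
    equations below left-hand sides with a syntactically recognizable head. *)
Definition bapp P Q (f : bihom P Q) n m (x : P n m) : Q n m := f n m x.

Lemma bihom_ext P Q (G : gens P) (f g : bihom P Q) : generates G ->
  (forall n m x, G n m x -> bapp f x = bapp g x) -> f = g.
Proof.
move=> gG fg; apply/functional_extensionality_dep => n.
apply/functional_extensionality_dep => m; apply: linear_ext.
exact: spans_linear (gG n m) (fg n m).
Qed.

(** All elements: the generating set used for an arbitrary factor. *)
Definition all_gen P : gens P := fun _ _ _ => True.

Lemma all_genP P : generates (@all_gen P).
Proof. by move=> n m U f g _ _ fg x; exact: fg. Qed.

(** The pure tensors whose factors belong to given sets. *)
Inductive hgen P Q (G : gens P) (H : gens Q) n m : htens P Q n m -> Prop :=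
  HGen : forall n1 m1 (p : P n1 m1), G n1 m1 p ->
    forall n2 m2 (q : Q n2 m2), H n2 m2 q ->
    forall (en : (n1 + n2 = n)%N) (em : (m1 + m2 = m)%N),
    hgen G H (hpure en em p q).

Lemma hgenP P Q (G : gens P) (H : gens Q) :
  generates G -> generates H -> generates (hgen G H).
Proof.
move=> gG gH n m U f g fL gL fg; apply: tsum_ext => //.
move=> [[[n1 m1] [n2 m2]] /= nm]; have [/eqP en /eqP em] := andP nm.
have -> : nm = bisplit_proof en em by exact: bool_irrelevance.
apply: (spans_bilinear (gG n1 m1) (gH n2 m2)
  (bilinear_postcomp (hpure_bilinear _ _ en em) fL)
  (bilinear_postcomp (hpure_bilinear _ _ en em) gL)) => p q Gp Hq.
by apply: fg; exact: HGen.
Qed.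

(** The same for the vertical tensor product. *)
Inductive vgen P Q (G : gens P) (H : gens Q) n m : vtens P Q n m -> Prop :=
  VGen : forall k (p : P n k), G n k p -> forall q : Q k m, H k m q ->
    vgen G H (vpure p q).

Lemma vgenP P Q (G : gens P) (H : gens Q) :
  generates G -> generates H -> generates (vgen G H).
Proof.
move=> gG gH n m U f g fL gL fg; apply: tsum_ext => // k.
apply: (spans_bilinear (gG n k) (gH k m)
  (bilinear_postcomp (vpure_bilinear _ _ n k m) fL)
  (bilinear_postcomp (vpure_bilinear _ _ n k m) gL)) => p q Gp Hq.
by apply: fg; exact: VGen.
Qed.

(** The generator 1_0 of the horizontal unit. *)
Inductive hunit_gen : gens (hunit K) := HOne : hunit_gen (hone K).

(** The generators 1_n of the vertical unit. *)
Inductive vunit_gen : gens (vunit K) := VOne n : vunit_gen (vone K n).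

(** When [b] fails, [kspace K b] is zero and is spanned by the empty set. *)
Lemma spans_kspace b (G : kspace K b -> Prop) : (b -> G (kone b)) -> spans G.
Proof.
move=> Gb U f g fL gL fg c.
have lin h : linear h -> h c = kcoef c *: h (kone b) :> U.
  move=> hL; have h0 : h 0 = 0.
    by have := hL (-1) 0 0; rewrite scaler0 addr0 scaleN1r addNr.
  by have := hL (kcoef c) (kone b) 0; rewrite h0 !addr0 -kspaceE.
rewrite (lin _ fL) (lin _ gL); case: b => [|] in G Gb f g fL gL fg c lin *.
  by rewrite fg //; exact: Gb.
by rewrite /= !scale0r.
Qed.

Lemma hunit_genP : generates hunit_gen.
Proof.
move=> n m; apply: (@spans_kspace _ (@hunit_gen n m)).
by case: n => [|n] //; case: m => [|m].
Qed.

Lemma vunit_genP : generates vunit_gen.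
Proof.
move=> n m; apply: (@spans_kspace (n == m) (@vunit_gen n m)) => /eqP e.
by subst m; exact: VOne.
Qed.

Lemma generates_sub P (G H : gens P) : generates G ->
  (forall n m x, G n m x -> H n m x) -> generates H.
Proof.
move=> gG GH n m U f g fL gL fg; apply: (gG n m U f g fL gL) => x Gx.
by apply: fg; exact: GH.
Qed.

(** The pure tensors having the generator of the unit as a factor, for which the
    degrees of the other factor are those of the tensor. *)
Inductive hlgen P (G : gens P) n m : htens (hunit K) P n m -> Prop :=
  HLGen : forall p : P n m, G n m p ->
    hlgen G (hpure (add0n n) (add0n m) (hone K) p).

Lemma hlgenP P (G : gens P) : generates G -> generates (hlgen G).
Proof.
move=> /(hgenP hunit_genP)/generates_sub; apply=> n m x.
case=> _ _ _ [] n2 m2 p Gp en em; have en' : n2 = n := en.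
have em' : m2 = m := em; move: en em; case: _ / en'; case: _ / em' => en em.
rewrite (eq_irrelevance en (add0n n2)) (eq_irrelevance em (add0n m2)).
exact: HLGen.
Qed.

(** The same with the unit on the right. *)
Inductive hrgen P (G : gens P) n m : htens P (hunit K) n m -> Prop :=
  HRGen : forall p : P n m, G n m p ->
    hrgen G (hpure (addn0 n) (addn0 m) p (hone K)).

Lemma hrgenP P (G : gens P) : generates G -> generates (hrgen G).
Proof.
move=> /hgenP/(_ hunit_genP)/generates_sub; apply=> n m x.
case=> n1 m1 p Gp _ _ _ [] en em.
have en' := en; have em' := em; rewrite !addn0 in en' em'.
move: en em; case: _ / en'; case: _ / em' => en em.
rewrite (eq_irrelevance en (addn0 n1)) (eq_irrelevance em (addn0 m1)).
exact: HRGen.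
Qed.

(** The vertical pure tensors whose first factor is the generator 1_n. *)
Inductive vlgen P (G : gens P) n m : vtens (vunit K) P n m -> Prop :=
  VLGen : forall p : P n m, G n m p -> vlgen G (vpure (vone K n) p).

Lemma vlgenP P (G : gens P) : generates G -> generates (vlgen G).
Proof.
move=> /(vgenP vunit_genP)/generates_sub; apply=> n m _ [k p up].
by case: n k p / up => n q Gq; exact: VLGen.
Qed.

(** The vertical pure tensors whose second factor is the generator 1_m. *)
Inductive vrgen P (G : gens P) n m : vtens P (vunit K) n m -> Prop :=
  VRGen : forall p : P n m, G n m p -> vrgen G (vpure p (vone K m)).

Lemma vrgenP P (G : gens P) : generates G -> generates (vrgen G).
Proof.
move=> /vgenP/(_ vunit_genP)/generates_sub; apply=> n m _ [k p Gp q uq].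
by case: k m q / uq p Gp => m p Gp; exact: VRGen.
Qed.

(** * Changes of bidegree in pure tensors *)

Lemma hpure_irr P Q n m n1 m1 n2 m2 (en en' : (n1 + n2 = n)%N)
    (em em' : (m1 + m2 = m)%N) (p : P n1 m1) (q : Q n2 m2) :
  hpure en em p q = hpure en' em' p q.
Proof. by rewrite (eq_irrelevance en en') (eq_irrelevance em em'). Qed.

Lemma hpure_castr P Q S n m n1 m1 n2 m2 n3 m3 d e d' e'
    (en2 : (n2 + n3 = d)%N) (em2 : (m2 + m3 = e)%N)
    (en2' : (n2 + n3 = d')%N) (em2' : (m2 + m3 = e')%N)
    (en : (n1 + d = n)%N) (em : (m1 + e = m)%N)
    (en' : (n1 + d' = n)%N) (em' : (m1 + e' = m)%N)
    (p : P n1 m1) (q : Q n2 m2) (r : S n3 m3) :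
  hpure en em p (hpure en2 em2 q r) = hpure en' em' p (hpure en2' em2' q r).
Proof. by subst d d' e e'; exact: hpure_irr. Qed.

Lemma hpure_castl P Q S n m n1 m1 n2 m2 n3 m3 d e d' e'
    (en1 : (n1 + n2 = d)%N) (em1 : (m1 + m2 = e)%N)
    (en1' : (n1 + n2 = d')%N) (em1' : (m1 + m2 = e')%N)
    (en : (d + n3 = n)%N) (em : (e + m3 = m)%N)
    (en' : (d' + n3 = n)%N) (em' : (e' + m3 = m)%N)
    (p : P n1 m1) (q : Q n2 m2) (r : S n3 m3) :
  hpure en em (hpure en1 em1 p q) r = hpure en' em' (hpure en1' em1' p q) r.
Proof. by subst d d' e e'; exact: hpure_irr. Qed.

Lemma hpure_transpr P Q n m n1 m1 n2 m2 n2' m2' (e1 : n2 = n2') (e2 : m2 = m2')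
    (en : (n1 + n2' = n)%N) (em : (m1 + m2' = m)%N)
    (en' : (n1 + n2 = n)%N) (em' : (m1 + m2 = m)%N)
    (p : P n1 m1) (q : Q n2 m2) :
  hpure en em p (transp Q q) = hpure en' em' p q.
Proof. by subst n2' m2'; rewrite transp_id; exact: hpure_irr. Qed.

Lemma vpure_transp P Q n m k k' (p : P n k) (q : Q k m) : k = k' ->
  vpure (transp P p : P n k') (transp Q q : Q k' m) = vpure p q.
Proof. by move=> e; subst k'; rewrite !transp_id. Qed.

(** The middle degree [j] of the vertical tensor product can be replaced by
    [k + l]. *)
Lemma vpure_hpure P P' Q Q' n m n1 n2 m1 m2 k l j
    (en en' : (n1 + n2 = n)%N) (em em' : (m1 + m2 = m)%N)
    (e e' : (k + l = j)%N)
    (p : P n1 k) (q : Q n2 l) (p' : P' k m1) (q' : Q' l m2) :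
  vpure (hpure en e p q) (hpure e' em p' q') =
  vpure (hpure en' erefl p q) (hpure erefl em' p' q').
Proof.
subst j; rewrite (eq_irrelevance e' erefl).
by rewrite (eq_irrelevance en en') (eq_irrelevance em em').
Qed.

(** * Values of the structure maps on pure tensors *)

(** Identities and composites in [Coll2 K], with [bihom] as their type. *)
Definition biid P : bihom P P := @idm (Coll2 K) P.
Definition bicomp P Q S (g : bihom Q S) (f : bihom P Q) : bihom P S :=
  @compm (Coll2 K) P Q S g f.
Local Notation "g \bo f" := (bicomp g f) (at level 50, left associativity).

Lemma bicompE P Q S (g : bihom Q S) (f : bihom P Q) n m (x : P n m) :
  bapp (g \bo f) x = bapp g (bapp f x).
Proof. by []. Qed.

Lemma biidE P n m (x : P n m) : bapp (biid P) x = x.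
Proof. by []. Qed.

Lemma hmap_pureE P P' Q Q' (f : bihom P P') (g : bihom Q Q') n m n1 m1 n2 m2
    (en : (n1 + n2 = n)%N) (em : (m1 + m2 = m)%N) (p : P n1 m1) (q : Q n2 m2) :
  bapp (hmap f g) (hpure en em p q) = hpure en em (bapp f p) (bapp g q).
Proof. exact: hmapE. Qed.

Lemma vmap_pureE P P' Q Q' (f : bihom P P') (g : bihom Q Q') n k m
    (p : P n k) (q : Q k m) :
  bapp (vmap f g) (vpure p q) = vpure (bapp f p) (bapp g q).
Proof. exact: vmapE. Qed.

Lemma hassoc_pureE P Q S n m n12 m12 n1 m1 n2 m2 n3 m3
    (en12 : (n1 + n2 = n12)%N) (em12 : (m1 + m2 = m12)%N)
    (en : (n12 + n3 = n)%N) (em : (m12 + m3 = m)%N)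
    (p : P n1 m1) (q : Q n2 m2) (r : S n3 m3) :
  bapp (hassoc P Q S) (hpure en em (hpure en12 em12 p q) r) =
  hpure (hassoc_subproof en12 en) (hassoc_subproof em12 em) p
    (hpure erefl erefl q r).
Proof. exact: hassocE. Qed.

Lemma vassoc_pureE P Q S n m k l (p : P n l) (q : Q l k) (s : S k m) :
  bapp (vassoc P Q S) (vpure (vpure p q) s) = vpure p (vpure q s).
Proof. exact: vassocE. Qed.

Lemma exchange_pureE (C1 C2 C3 C4 : bicoll K) n m n1 n2 m1 m2 k l
    (en : (n1 + n2 = n)%N) (em : (m1 + m2 = m)%N)
    (p1 : C1 n1 k) (p2 : C2 k m1) (p3 : C3 n2 l) (p4 : C4 l m2) :
  bapp (exchange C1 C2 C3 C4) (hpure en em (vpure p1 p2) (vpure p3 p4)) =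
  vpure (hpure en (erefl (k + l)%N) p1 p3) (hpure (erefl (k + l)%N) em p2 p4).
Proof. exact: exchangeE. Qed.

Lemma hlunit_pureE P n m n' m' (en : (0 + n = n')%N) (em : (0 + m = m')%N)
    (p : P n m) : bapp (hlunit P) (hpure en em (hone K) p) = transp P p.
Proof. by rewrite /bapp /hlunit /hpure slift_pure scale1r. Qed.

Lemma hrunit_pureE P n m n' m' (en : (n + 0 = n')%N) (em : (m + 0 = m')%N)
    (p : P n m) : bapp (hrunit P) (hpure en em p (hone K)) = transp P p.
Proof. by rewrite /bapp /hrunit /hpure slift_pure scale1r. Qed.

Lemma vlunit_pureE P n m (p : P n m) :
  bapp (vlunit P) (vpure (vone K n) p) = p.
Proof. exact: vlunitE. Qed.

Lemma vrunit_pureE P n m (p : P n m) :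
  bapp (vrunit P) (vpure p (vone K m)) = p.
Proof. exact: vrunitE. Qed.

Lemma hunit_dup_oneE : bapp (hunit_dup K) (hone K) = vpure (hone K) (hone K).
Proof. exact: hunit_dupE. Qed.

Lemma hunit_vunit_oneE : bapp (hunit_vunit K) (hone K) = vone K 0.
Proof. exact: hunit_vunitE. Qed.

Lemma vunit_mul_pureE a b n (en em : (a + b = n)%N) :
  bapp (vunit_mul K) (hpure en em (vone K a) (vone K b)) = vone K n.
Proof. by subst n; rewrite (eq_irrelevance em erefl); exact: vunit_mulE. Qed.

(** * The inverses of the associators *)

Lemma hassoc_inv_subproof a b c d e : (b + c = d)%N -> (a + d = e)%N ->
  (a + b + c = e)%N.
Proof. by move=> <- <-; rewrite addnA. Qed.

Section Inverse.
Variables (P Q S : bicoll K) (n m : nat).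

(** The element p is the last argument, so that the map is bilinear in the
    first two arguments with values in the linear functions of p. *)
Definition hassoc_inv_pure (s : bisplit n m) (t : bisplit (sn2 s) (sm2 s))
    (q : Q (sn1 t) (sm1 t)) (r : S (sn2 t) (sm2 t)) (p : P (sn1 s) (sm1 s)) :
    htens (htens P Q) S n m :=
  hpure (hassoc_inv_subproof (bisplit_n t) (bisplit_n s))
        (hassoc_inv_subproof (bisplit_m t) (bisplit_m s))
        (hpure erefl erefl p q) r.

Lemma hassoc_inv_pure_bilinear s t : bilinear_map (@hassoc_inv_pure s t).
Proof.
split=> [r|q] a x y; apply/funext => p; rewrite /hassoc_inv_pure.
- by rewrite (hpure_bilinear _ _ _ _).2 (hpure_bilinear _ _ _ _).1.
- exact: (hpure_bilinear _ _ _ _).2.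
Qed.

Lemma hassoc_inv_pure_linear s t q r : linear (@hassoc_inv_pure s t q r).
Proof.
move=> a x y; rewrite /hassoc_inv_pure.
by rewrite !(hpure_bilinear _ _ _ _).1.
Qed.

(** p (x) (q (x) r) |-> (p (x) q) (x) r. *)
Definition hassoc_inv :
    {linear htens P (htens Q S) n m -> htens (htens P Q) S n m} :=
  slift (fun s => bilinear_flip
    (slift_curry_bilinear (@hassoc_inv_pure_bilinear s)
       (@hassoc_inv_pure_linear s))).

(** The vertical counterpart of [hassoc_inv_pure]. *)
Definition vassoc_inv_pure k l (q : Q k l) (s : S l m) (p : P n k) :
  vtens (vtens P Q) S n m := vpure (vpure p q) s.

Lemma vassoc_inv_pure_bilinear k l : bilinear_map (@vassoc_inv_pure k l).
Proof.
split=> [s|q] a x y; apply/funext => p; rewrite /vassoc_inv_pure.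
- by rewrite (vpure_bilinear _ _ _ _ _).2 (vpure_bilinear _ _ _ _ _).1.
- exact: (vpure_bilinear _ _ _ _ _).2.
Qed.

Lemma vassoc_inv_pure_linear k l q s : linear (@vassoc_inv_pure k l q s).
Proof.
move=> a x y; rewrite /vassoc_inv_pure.
by rewrite !(vpure_bilinear _ _ _ _ _).1.
Qed.

Definition vassoc_inv :
    {linear vtens P (vtens Q S) n m -> vtens (vtens P Q) S n m} :=
  slift (fun k => bilinear_flip
    (slift_curry_bilinear (@vassoc_inv_pure_bilinear k)
       (@vassoc_inv_pure_linear k))).
End Inverse.

Lemma hassoc_inv_pureE P Q S n m n23 m23 n1 m1 n2 m2 n3 m3
    (en23 : (n2 + n3 = n23)%N) (em23 : (m2 + m3 = m23)%N)
    (en : (n1 + n23 = n)%N) (em : (m1 + m23 = m)%N)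
    (p : P n1 m1) (q : Q n2 m2) (r : S n3 m3) :
  hassoc_inv P Q S n m (hpure en em p (hpure en23 em23 q r)) =
  hpure (hassoc_inv_subproof en23 en) (hassoc_inv_subproof em23 em)
    (hpure erefl erefl p q) r.
Proof.
rewrite /hassoc_inv {1}/hpure slift_pure {1}/hpure slift_pure.
exact: hpure_irr.
Qed.

Lemma vassoc_inv_pureE P Q S n m k l (p : P n k) (q : Q k l) (s : S l m) :
  vassoc_inv P Q S n m (vpure p (vpure q s)) = vpure (vpure p q) s.
Proof. by rewrite /vassoc_inv /vpure !slift_pure. Qed.

(** * The two monoidal structures *)

(* The equations of [bieval] are applied with [autorewrite], which matches their
   left-hand sides syntactically: matching up to unfolding compares the
   underlying linear maps, and is very slow. *)
#[local] Hint Rewrite bicompE biidE hmap_pureE vmap_pureE hassoc_pureE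
  vassoc_pureE exchange_pureE hlunit_pureE hrunit_pureE vlunit_pureE
  vrunit_pureE hunit_dup_oneE hunit_vunit_oneE vunit_mul_pureE : bieval.

Local Notation TP := (@all_genP _).

Lemma Coll2_is_category : is_category (Coll2 K).
Proof. by split=> *; apply: bihom_ext TP _. Qed.

Lemma hassoc_natural P P' Q Q' S S' (f : bihom P P') (g : bihom Q Q')
    (h : bihom S S') :
  hmap f (hmap g h) \bo hassoc P Q S = hassoc P' Q' S' \bo hmap (hmap f g) h.
Proof.
apply: bihom_ext (hgenP (hgenP TP TP) TP) _.
move=> n m _ [n12 m12 _ [n1 m1 p _ n2 m2 q _ en12 em12] n3 m3 r _ en em].
by autorewrite with bieval.
Qed.

Lemma hpentagon P Q S T :
  hassoc P Q (htens S T) \bo hassoc (htens P Q) S T =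
  hmap (biid P) (hassoc Q S T) \bo hassoc P (htens Q S) T
    \bo hmap (hassoc P Q S) (biid T).
Proof.
apply: bihom_ext (hgenP (hgenP (hgenP TP TP) TP) TP) _.
move=> n m _ [n123 m123 _ [n12 m12 _ [n1 m1 p _ n2 m2 q _ en12 em12]
  n3 m3 r _ en123 em123] n4 m4 s _ en em].
autorewrite with bieval.
exact/esym/hpure_castr.
Qed.

(** A morphism is invertible as soon as it has linear, degreewise inverses on
    generators. *)
Lemma is_iso_generators P Q (G : gens P) (H : gens Q) (f : bihom P Q)
    (g : forall n m, Q n m -> P n m) :
  (forall n m, linear (g n m)) -> generates G -> generates H ->
  (forall n m x, G n m x -> g n m (bapp f x) = x) ->
  (forall n m y, H n m y -> bapp f (g n m y) = y) ->
  @is_iso (Coll2 K) P Q f.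
Proof.
move=> gL gG gH gf fg.
(* The functions g n m, packed as linear maps. *)
pose gl : bihom Q P := fun n m =>
  HB.pack (g n m)
    (GRing.isLinear.Build K (Q n m) (P n m) *:%R (g n m) (gL n m)).
exists gl.
- exact: (@bihom_ext P P G (gl \bo f) (biid P) gG gf).
- exact: (@bihom_ext Q Q H (f \bo gl) (biid Q) gH fg).
Qed.

Lemma hmap_functor : is_functor (tensor_functor (Coll2_h K)).
Proof.
split=> [[P Q]|[P Q] [P' Q'] [P'' Q''] [g g'] [f f']].
  apply: bihom_ext (hgenP TP TP) _.
  move=> n m _ [n1 m1 p _ n2 m2 q _ en em].
  exact: (hmap_pureE (biid P) (biid Q)).
change (hmap (g \bo f) (g' \bo f') = hmap g g' \bo hmap f f').
apply: bihom_ext (hgenP TP TP) _ => n m _ [n1 m1 p _ n2 m2 q _ en em].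
by autorewrite with bieval.
Qed.

Lemma vmap_functor : is_functor (tensor_functor (Coll2_v K)).
Proof.
split=> [[P Q]|[P Q] [P' Q'] [P'' Q''] [g g'] [f f']].
  apply: bihom_ext (vgenP TP TP) _ => n m _ [k p _ q _].
  exact: (vmap_pureE (biid P) (biid Q)).
change (vmap (g \bo f) (g' \bo f') = vmap g g' \bo vmap f f').
apply: bihom_ext (vgenP TP TP) _ => n m _ [k p _ q _].
by autorewrite with bieval.
Qed.

Lemma hlunit_natural P P' (f : bihom P P') :
  f \bo hlunit P = hlunit P' \bo hmap (biid (hunit K)) f.
Proof.
apply: bihom_ext (hlgenP TP) _ => n m _ [p _].
by autorewrite with bieval; rewrite !transp_id.
Qed.

Lemma hrunit_natural P P' (f : bihom P P') :
  f \bo hrunit P = hrunit P' \bo hmap f (biid (hunit K)).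
Proof.
apply: bihom_ext (hrgenP TP) _ => n m _ [p _].
by autorewrite with bieval; rewrite !transp_id.
Qed.

Lemma vassoc_natural P P' Q Q' S S' (f : bihom P P') (g : bihom Q Q')
    (h : bihom S S') :
  vmap f (vmap g h) \bo vassoc P Q S = vassoc P' Q' S' \bo vmap (vmap f g) h.
Proof.
apply: bihom_ext (vgenP (vgenP TP TP) TP) _.
move=> n m _ [k _ [l p _ q _] r _].
by autorewrite with bieval.
Qed.

Lemma vlunit_natural P P' (f : bihom P P') :
  f \bo vlunit P = vlunit P' \bo vmap (biid (vunit K)) f.
Proof.
apply: bihom_ext (vlgenP TP) _ => n m _ [p _].
by autorewrite with bieval.
Qed.

Lemma vrunit_natural P P' (f : bihom P P') :
  f \bo vrunit P = vrunit P' \bo vmap f (biid (vunit K)).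
Proof.
apply: bihom_ext (vrgenP TP) _ => n m _ [p _].
by autorewrite with bieval.
Qed.

Lemma vpentagon P Q S U :
  vassoc P Q (vtens S U) \bo vassoc (vtens P Q) S U =
  vmap (biid P) (vassoc Q S U) \bo vassoc P (vtens Q S) U
    \bo vmap (vassoc P Q S) (biid U).
Proof.
apply: bihom_ext (vgenP (vgenP (vgenP TP TP) TP) TP) _.
move=> n m _ [k _ [l _ [j p _ q _] r _] s _].
by autorewrite with bieval.
Qed.

Lemma htriangle P Q :
  hmap (biid P) (hlunit Q) \bo hassoc P (hunit K) Q =
  hmap (hrunit P) (biid Q).
Proof.
apply: bihom_ext (hgenP (hrgenP TP) TP) _.
move=> n m _ [n1 m1 _ [p _] n2 m2 q _ en em].
autorewrite with bieval; rewrite transp_id.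
exact: hpure_transpr.
Qed.

Lemma vtriangle P Q :
  vmap (biid P) (vlunit Q) \bo vassoc P (vunit K) Q =
  vmap (vrunit P) (biid Q).
Proof.
apply: bihom_ext (vgenP (vrgenP TP) TP) _ => n m _ [k _ [p _] q _].
by autorewrite with bieval.
Qed.

Lemma hassoc_iso P Q S : @is_iso (Coll2 K) _ _ (hassoc P Q S).
Proof.
apply: (is_iso_generators (g := fun n m => @hassoc_inv P Q S n m) _
  (hgenP (hgenP TP TP) TP) (hgenP TP (hgenP TP TP))) => n m.
- exact: linearP.
- move=> _ [n12 m12 _ [n1 m1 p _ n2 m2 q _ en12 em12] n3 m3 r _ en em].
  rewrite hassoc_pureE hassoc_inv_pureE; exact: hpure_castl.
- move=> _ [n1 m1 p _ n23 m23 _ [n2 m2 q _ n3 m3 r _ en23 em23] en em].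
  rewrite hassoc_inv_pureE hassoc_pureE; exact: hpure_castr.
Qed.

Lemma vassoc_iso P Q S : @is_iso (Coll2 K) _ _ (vassoc P Q S).
Proof.
apply: (is_iso_generators (g := fun n m => @vassoc_inv P Q S n m) _
  (vgenP (vgenP TP TP) TP) (vgenP TP (vgenP TP TP))) => n m.
- exact: linearP.
- move=> _ [k _ [l p _ q _] r _].
  by rewrite vassoc_pureE vassoc_inv_pureE.
- move=> _ [k p _ _ [l q _ r _]].
  by rewrite vassoc_inv_pureE vassoc_pureE.
Qed.

Lemma hlunit_iso P : @is_iso (Coll2 K) _ _ (hlunit P).
Proof.
apply: (is_iso_generators
  (g := fun n m p => hpure (add0n n) (add0n m) (hone K) p) _
  (hlgenP TP) TP) => n m.
- exact: (hpure_bilinear _ _ _ _).2.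
- by move=> _ [p _]; rewrite hlunit_pureE transp_id.
- by move=> p _; rewrite hlunit_pureE transp_id.
Qed.

Lemma hrunit_iso P : @is_iso (Coll2 K) _ _ (hrunit P).
Proof.
apply: (is_iso_generators
  (g := fun n m p => hpure (addn0 n) (addn0 m) p (hone K)) _
  (hrgenP TP) TP) => n m.
- exact: (hpure_bilinear _ _ _ _).1.
- by move=> _ [p _]; rewrite hrunit_pureE transp_id.
- by move=> p _; rewrite hrunit_pureE transp_id.
Qed.

Lemma vlunit_iso P : @is_iso (Coll2 K) _ _ (vlunit P).
Proof.
apply: (is_iso_generators (g := fun n m p => vpure (vone K n) p) _
  (vlgenP TP) TP) => n m.
- exact: (vpure_bilinear _ _ _ _ _).2.
- by move=> _ [p _]; rewrite vlunit_pureE.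
- by move=> p _; rewrite vlunit_pureE.
Qed.

Lemma vrunit_iso P : @is_iso (Coll2 K) _ _ (vrunit P).
Proof.
apply: (is_iso_generators (g := fun n m p => vpure p (vone K m)) _
  (vrgenP TP) TP) => n m.
- exact: (vpure_bilinear _ _ _ _ _).1.
- by move=> _ [p _]; rewrite vrunit_pureE.
- by move=> p _; rewrite vrunit_pureE.
Qed.

Lemma Coll2_h_is_monoidal : is_monoidal (Coll2_h K).
Proof.
split.
- exact: hmap_functor.
- move=> [[P Q] S] [[P' Q'] S'] [[f g] h]; exact: (hassoc_natural f g h).
- move=> P P' f; exact: hlunit_natural.
- move=> P P' f; exact: hrunit_natural.
- exact: hassoc_iso.
- exact: hlunit_iso.
- exact: hrunit_iso.
- exact: hpentagon.
- exact: htriangle.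
Qed.

Lemma Coll2_v_is_monoidal : is_monoidal (Coll2_v K).
Proof.
split.
- exact: vmap_functor.
- move=> [[P Q] S] [[P' Q'] S'] [[f g] h]; exact: (vassoc_natural f g h).
- move=> P P' f; exact: vlunit_natural.
- move=> P P' f; exact: vrunit_natural.
- exact: vassoc_iso.
- exact: vlunit_iso.
- exact: vrunit_iso.
- exact: vpentagon.
- exact: vtriangle.
Qed.

(** * The exchange map as a lax structure on the vertical tensor product *)

Lemma exchange_natural C1 C2 C3 C4 D1 D2 D3 D4 (f1 : bihom C1 D1)
    (f2 : bihom C2 D2) (f3 : bihom C3 D3) (f4 : bihom C4 D4) :
  vmap (hmap f1 f3) (hmap f2 f4) \bo exchange C1 C2 C3 C4 =
  exchange D1 D2 D3 D4 \bo hmap (vmap f1 f2) (vmap f3 f4).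
Proof.
apply: bihom_ext (hgenP (vgenP TP TP) (vgenP TP TP)) _.
move=> n m _ [n1 m1 _ [k p _ q _] n2 m2 _ [l r _ s _] en em].
by autorewrite with bieval.
Qed.

Lemma exchange_hassoc A1 A2 B1 B2 C1 C2 :
  vmap (hassoc A1 B1 C1) (hassoc A2 B2 C2)
    \bo exchange (htens A1 B1) (htens A2 B2) C1 C2
    \bo hmap (exchange A1 A2 B1 B2) (biid (vtens C1 C2)) =
  exchange A1 A2 (htens B1 C1) (htens B2 C2)
    \bo hmap (biid (vtens A1 A2)) (exchange B1 B2 C1 C2)
    \bo hassoc (vtens A1 A2) (vtens B1 B2) (vtens C1 C2).
Proof.
apply: bihom_ext (hgenP (hgenP (vgenP TP TP) (vgenP TP TP)) (vgenP TP TP)) _.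
move=> n m _ [n12 m12 _ [n1 m1 _ [k a _ a' _] n2 m2 _ [l b _ b' _] en12 em12]
  n3 m3 _ [j c _ c' _] en em].
autorewrite with bieval.
(* The middle degrees are k + l + j on the left and k + (l + j) on the right. *)
exact: vpure_hpure.
Qed.

Lemma exchange_hlunit A1 A2 :
  vmap (hlunit A1) (hlunit A2) \bo exchange (hunit K) (hunit K) A1 A2
    \bo hmap (hunit_dup K) (biid (vtens A1 A2)) = hlunit (vtens A1 A2).
Proof.
apply: bihom_ext (hlgenP (vgenP TP TP)) _ => n m _ [_ [k p _ q _]].
by autorewrite with bieval; rewrite vpure_transp // transp_id.
Qed.

Lemma exchange_hrunit A1 A2 :
  vmap (hrunit A1) (hrunit A2) \bo exchange A1 A2 (hunit K) (hunit K)
    \bo hmap (biid (vtens A1 A2)) (hunit_dup K) = hrunit (vtens A1 A2).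
Proof.
apply: bihom_ext (hrgenP (vgenP TP TP)) _ => n m _ [_ [k p _ q _]].
by autorewrite with bieval; rewrite vpure_transp ?addn0 // transp_id.
Qed.

Lemma Coll2_exchange_is_lax : is_lax_monoidal (Coll2_exchange K).
Proof.
split.
- exact: vmap_functor.
- move=> [C1 C2] [D1 D2] [C3 C4] [D3 D4] [f1 f2] [f3 f4].
  exact: exchange_natural.
- move=> [A1 A2] [B1 B2] [C1 C2]; exact: exchange_hassoc.
- move=> [A1 A2]; exact: exchange_hlunit.
- move=> [A1 A2]; exact: exchange_hrunit.
Qed.

(** * The lax structure on the vertical unit *)

Local Notation V1 := (vunit K).

Lemma vunit_mul_natural :
  biid V1 \bo vunit_mul K = vunit_mul K \bo hmap (biid V1) (biid V1).
Proof.
apply: bihom_ext (hgenP TP TP) _ => n m _ [n1 m1 p _ n2 m2 q _ en em].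
by autorewrite with bieval.
Qed.

Lemma vunit_mul_assoc :
  biid V1 \bo vunit_mul K \bo hmap (vunit_mul K) (biid V1) =
  vunit_mul K \bo hmap (biid V1) (vunit_mul K) \bo hassoc V1 V1 V1.
Proof.
apply: bihom_ext (hgenP (hgenP vunit_genP vunit_genP) vunit_genP) _.
move=> n m _ [n12 m12 _ [_ _ _ [a] _ _ _ [b] en12 em12] _ _ _ [c] en em].
autorewrite with bieval; subst n12 m12 n m.
by rewrite !vunit_mul_pureE.
Qed.

Lemma vunit_mul_lunit :
  biid V1 \bo vunit_mul K \bo hmap (hunit_vunit K) (biid V1) = hlunit V1.
Proof.
apply: bihom_ext (hlgenP vunit_genP) _ => n m _ [_ [a]].
by autorewrite with bieval; rewrite transp_id.
Qed.

Lemma vunit_mul_runit :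
  biid V1 \bo vunit_mul K \bo hmap (biid V1) (hunit_vunit K) = hrunit V1.
Proof.
apply: bihom_ext (hrgenP vunit_genP) _ => n m _ [_ [a]].
by autorewrite with bieval; rewrite transp_id.
Qed.

Lemma Coll2_vunit_is_lax : is_lax_monoidal (Coll2_vunit K).
Proof.
split.
- split=> [[]|[] [] [] [] []]; exact: bihom_ext TP _.
- move=> [] [] [] [] [] []; exact: vunit_mul_natural.
- move=> [] [] []; exact: vunit_mul_assoc.
- move=> []; exact: vunit_mul_lunit.
- move=> []; exact: vunit_mul_runit.
Qed.

(** * The vertical coherence isomorphisms as monoidal transformations *)

(** In the statements below, the identities and the maps induced by them are
    those produced by composing lax structures with the projections and with
    the identity functor. *)
Lemma exchange_vassoc A B C A' B' C' :
  vassoc (htens A A') (htens B B') (htens C C') \bo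
    (vmap (vmap (biid _) (biid _) \bo exchange A B A' B') (biid _)
      \bo exchange (vtens A B) C (vtens A' B') C') =
  (vmap (biid _ \bo biid _)
        (vmap (biid _ \bo biid _) (biid _) \bo exchange B C B' C')
    \bo exchange A (vtens B C) A' (vtens B' C'))
    \bo hmap (vassoc A B C) (vassoc A' B' C').
Proof.
apply: bihom_ext (hgenP (vgenP (vgenP TP TP) TP) (vgenP (vgenP TP TP) TP)) _.
move=> n m _ [n1 m1 _ [k _ [j a _ b _] c _]].
move=> n2 m2 _ [k' _ [j' a' _ b' _] c' _] en em.
by autorewrite with bieval.
Qed.

Local Notation H1 := (hunit K).

Lemma hunit_dup_vassoc :
  vassoc H1 H1 H1 \bo
    (vmap (vmap (biid _) (biid _) \bo hunit_dup K) (biid _) \bo hunit_dup K) =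
  vmap (biid _ \bo biid _)
       (vmap (biid _ \bo biid _) (biid _) \bo hunit_dup K) \bo hunit_dup K.
Proof.
apply: bihom_ext hunit_genP _ => n m _ [].
by autorewrite with bieval.
Qed.

Lemma exchange_vlunit A B :
  vlunit (htens A B) \bo (vmap (biid _ \bo vunit_mul K) (biid _)
    \bo exchange V1 A V1 B) = biid _ \bo hmap (vlunit A) (vlunit B).
Proof.
apply: bihom_ext (hgenP (vlgenP TP) (vlgenP TP)) _.
move=> n m _ [n1 m1 _ [p _] n2 m2 _ [q _] en em].
autorewrite with bieval; subst n.
by rewrite vunit_mul_pureE vlunit_pureE.
Qed.

Lemma exchange_vrunit A B :
  vrunit (htens A B) \bo (vmap (biid _) (biid _ \bo vunit_mul K)
    \bo exchange A V1 B V1) = biid _ \bo hmap (vrunit A) (vrunit B).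
Proof.
apply: bihom_ext (hgenP (vrgenP TP) (vrgenP TP)) _.
move=> n m _ [n1 m1 _ [p _] n2 m2 _ [q _] en em].
autorewrite with bieval; subst m.
by rewrite vunit_mul_pureE vrunit_pureE.
Qed.

Lemma hunit_dup_vlunit :
  vlunit H1 \bo (vmap (biid _ \bo hunit_vunit K) (biid _) \bo hunit_dup K) =
  biid _.
Proof.
apply: bihom_ext hunit_genP _ => n m _ [].
by autorewrite with bieval.
Qed.

Lemma hunit_dup_vrunit :
  vrunit H1 \bo (vmap (biid _) (biid _ \bo hunit_vunit K) \bo hunit_dup K) =
  biid _.
Proof.
apply: bihom_ext hunit_genP _ => n m _ [].
by autorewrite with bieval.
Qed.

Lemma Coll2_is_duoidal :
  is_duoidal (Coll2 K) (Coll2_h K) (Coll2_v K) (Coll2_exchange K)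
    (Coll2_vunit K).
Proof.
split.
- exact: Coll2_is_category.
- exact: Coll2_h_is_monoidal.
- exact: Coll2_v_is_monoidal.
- exact: Coll2_exchange_is_lax.
- exact: Coll2_vunit_is_lax.
- split.
  + exact: massoc_natural Coll2_v_is_monoidal.
  + move=> [[A B] C] [[A' B'] C']; exact: (exchange_vassoc A B C A' B' C').
  + exact: hunit_dup_vassoc.
- split.
  + exact: mlunit_natural Coll2_v_is_monoidal.
  + exact: exchange_vlunit.
  + exact: hunit_dup_vlunit.
- split.
  + exact: mrunit_natural Coll2_v_is_monoidal.
  + exact: exchange_vrunit.
  + exact: hunit_dup_vrunit.
Qed.
End Generators.

Theorem mainTheorem1 (R : realType) :
  is_duoidal (Coll2 R[i]) (Coll2_h R[i]) (Coll2_v R[i])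
    (Coll2_exchange R[i]) (Coll2_vunit R[i]).
Proof. exact: Coll2_is_duoidal. Qed.
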